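(* Let $A$ be a positive self-adjoint operator in a separable Hilbert space $X$, let $\beta\in[0,1)$, and let $f:X^\beta\to X$ be Lipschitz with constant $L>0$, i.e. $\|f(u_1)-f(u_2)\|\le L\|u_1-u_2\|_\beta$ for all $u_1,u_2\in X^\beta$. If $u$ is a nonstationary (nonconstant) periodic solution, with values in $X^\beta$ and period $T>0$, of $$\dot u(t)+Au(t)=f(u(t)),$$ then $$T\ge\frac{1}{(LK_\beta)^{1/(1-\beta)}},$$ where $K_\beta:=\min_{\eta\in(0,1)}H(\eta)$ and $H:(0,1)\to(0,+\infty)$ is given by $$H(\eta):=\frac{\eta^\beta}{1-\eta}+\frac{M_\beta}{\eta}\left(e^{-\eta}+\eta^\beta\int_0^\eta s^{-\beta}e^{-s}\,ds\right),$$ with $M_\beta=(\beta/e)^\beta$ if $\beta\in(0,1)$ and $M_\beta=1$ if $\beta=0$. Consequently, $$T\ge\frac{1}{L^{1/(1-\beta)}\left(2^{1-\beta}+2M_\beta/e^{1/2}+M_\beta/(1-\beta)\right)^{1/(1-\beta)}}\quad\text{for }\beta\in(0,1),$$ and $T\ge\frac{1}{4L}$ for $\beta=0$.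
   Context: ''Positive'' means that the spectrum of $A$ is contained in $(0,+\infty)$. $X^\beta$ is the fractional power space, i.e. the domain of the fractional power $A^\beta$ with norm $\|u\|_\beta=\|A^\beta u\|$, where $\|\cdot\|$ is the norm of $X$ (so $X^0=X$). A periodic solution with period $T$ is a continuous $T$-periodic function $u:\mathbb{R}\to X^\beta$ that is a mild solution, i.e. $u(t)=e^{-(t-t_0)A}u(t_0)+\int_{t_0}^t e^{-(t-s)A}f(u(s))\,ds$ for all real $t_0<t$. *)

(* Defs.v *)
From Stdlib Require Import Reals ClassicalEpsilon.
From Coquelicot Require Import Coquelicot.
Open Scope R_scope.

(* A Hilbert space is a [CompleteNormedModule R_AbsRing] whose norm comes from
   an inner product.  Scalars are real; a complex Hilbert space is covered by
   restriction of scalars with the inner product Re<.,.>, which preserves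
   self-adjointness, positivity of the spectrum, e^{-tA} and A^beta. *)

Definition is_inner_product {X : NormedModule R_AbsRing} (ip : X -> X -> R)
  : Prop :=
  (forall x y, ip x y = ip y x) /\
  (forall x y z, ip (plus x y) z = ip x z + ip y z) /\
  (forall (a : R) x y, ip (scal a x) y = a * ip x y) /\
  (forall x, ip x x = norm x ^ 2).

Definition separable (X : NormedModule R_AbsRing) : Prop :=
  exists e : nat -> X,
    forall (x : X) (eps : R), 0 < eps -> exists n, norm (minus x (e n)) < eps.

(* A possibly unbounded linear operator; values outside [dom] are irrelevant. *)
Record operator (X : NormedModule R_AbsRing) := Operator {
  dom : X -> Prop;
  app : X -> X;
  dom_zero : dom zero;
  dom_plus : forall x y, dom x -> dom y -> dom (plus x y);
  dom_scal : forall (a : R) x, dom x -> dom (scal a x);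
  app_plus : forall x y, dom x -> dom y -> app (plus x y) = plus (app x) (app y);
  app_scal : forall (a : R) x, dom x -> app (scal a x) = scal a (app x)
}.
Arguments dom {X} _ _.
Arguments app {X} _ _.

Definition densely_defined {X : NormedModule R_AbsRing} (A : operator X)
  : Prop :=
  forall (x : X) (eps : R),
    0 < eps -> exists y, dom A y /\ norm (minus x y) < eps.

(* (y, z) belongs to the graph of the adjoint of A. *)
Definition adjoint_graph {X : NormedModule R_AbsRing} (ip : X -> X -> R)
    (A : operator X) (y z : X) : Prop :=
  forall x, dom A x -> ip (app A x) y = ip x z.

Definition self_adjoint {X : NormedModule R_AbsRing} (ip : X -> X -> R)
    (A : operator X) : Prop :=
  densely_defined A /\
  forall y z, adjoint_graph ip A y z <-> (dom A y /\ z = app A y).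

(* [is_linear] includes boundedness. *)
Definition resolvent_set {X : NormedModule R_AbsRing} (A : operator X)
    (lambda : R) : Prop :=
  exists Q : X -> X,
    is_linear Q /\
    (forall y, dom A (Q y) /\ minus (app A (Q y)) (scal lambda (Q y)) = y) /\
    (forall x, dom A x -> Q (minus (app A x) (scal lambda x)) = x).

Definition spectrum {X : NormedModule R_AbsRing} (A : operator X)
    (lambda : R) : Prop :=
  ~ resolvent_set A lambda.

Definition positive_operator {X : NormedModule R_AbsRing} (A : operator X) : Prop :=
  forall lambda, spectrum A lambda -> 0 < lambda.

Definition C0_semigroup {X : NormedModule R_AbsRing} (S : R -> X -> X)
  : Prop :=
  (forall t, 0 <= t -> is_linear (S t)) /\
  (forall x, S 0 x = x) /\
  (forall s t x, 0 <= s -> 0 <= t -> S (s + t) x = S s (S t x)) /\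
  (forall x, filterlim (fun t => S t x) (at_right 0) (locally x)).

Definition generator_graph {X : NormedModule R_AbsRing} (S : R -> X -> X)
    (x y : X) : Prop :=
  filterlim (fun h => scal (/ h) (minus (S h x) x)) (at_right 0) (locally y).

Definition generated_by_opp {X : NormedModule R_AbsRing} (A : operator X)
    (S : R -> X -> X) : Prop :=
  C0_semigroup S /\
  forall x y, generator_graph S x y <-> (dom A x /\ y = opp (app A x)).

(* [semigroup A t] is e^{-tA} for 0 <= t: the C0-semigroup generated by -A.
   It is unique on 0 <= t, and exists whenever A is positive self-adjoint;
   zero is a junk value for operators A such that -A is not a generator. *)
Definition semigroup {X : NormedModule R_AbsRing} (A : operator X)
  : R -> X -> X :=
  match excluded_middle_informative (exists S, generated_by_opp A S) with
  | left H => proj1_sig (constructive_indefinite_description _ H)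
  | right _ => fun _ _ => zero
  end.

Definition Gamma (b : R) : R :=
  RInt_gen (fun t => Rpower t (b - 1) * exp (- t))
    (at_right 0) (Rbar_locally p_infty).

(* The graph of A^beta for 0 <= beta.  A^0 = I and, for 0 < beta, A^beta is the
   inverse of
     A^{-beta} y = (1 / Gamma beta) int_0^oo t^(beta-1) e^{-tA} y dt. *)
Definition pow_graph {X : NormedModule R_AbsRing} (A : operator X)
    (beta : R) (x y : X) : Prop :=
  (beta = 0 /\ y = x) \/
  (0 < beta /\
   is_RInt_gen (fun t => scal (Rpower t (beta - 1)) (semigroup A t y))
     (at_right 0) (Rbar_locally p_infty) (scal (Gamma beta) x)).

(* X^beta, as a subset of X. *)
Definition pow_dom {X : NormedModule R_AbsRing} (A : operator X)
    (beta : R) (x : X) : Prop :=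
  exists y, pow_graph A beta x y.

Definition pow_app {X : NormedModule R_AbsRing} (A : operator X)
    (beta : R) (x : X) : X :=
  epsilon (inhabits zero) (pow_graph A beta x).

Definition pow_norm {X : NormedModule R_AbsRing} (A : operator X)
    (beta : R) (x : X) : R :=
  norm (pow_app A beta x).

(* f : X^beta -> X is given by a function on X, only its values on X^beta
   being relevant. *)
Definition pow_lipschitz {X : NormedModule R_AbsRing} (A : operator X)
    (beta L : R) (f : X -> X) : Prop :=
  forall u1 u2, pow_dom A beta u1 -> pow_dom A beta u2 ->
    norm (minus (f u1) (f u2)) <= L * pow_norm A beta (minus u1 u2).

Definition pow_continuous {X : NormedModule R_AbsRing} (A : operator X)
    (beta : R) (u : R -> X) : Prop :=
  (forall t, pow_dom A beta (u t)) /\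
  forall t, filterlim (fun s => pow_norm A beta (minus (u s) (u t)))
              (locally t) (locally 0).

Definition mild_solution {X : NormedModule R_AbsRing} (A : operator X)
    (f : X -> X) (u : R -> X) : Prop :=
  forall t0 t, t0 < t ->
    exists I : X,
      is_RInt (fun s => semigroup A (t - s) (f (u s))) t0 t I /\
      u t = plus (semigroup A (t - t0) (u t0)) I.

Definition periodic_solution {X : NormedModule R_AbsRing} (A : operator X)
    (beta : R) (f : X -> X) (u : R -> X) (T : R) : Prop :=
  pow_continuous A beta u /\
  (forall t, u (t + T) = u t) /\
  mild_solution A f u.

Definition M_ (beta : R) : R :=
  if Req_EM_T beta 0 then 1 else Rpower (beta / exp 1) beta.

Definition H_ (beta eta : R) : R :=
  Rpower eta beta / (1 - eta) +
  M_ beta / eta *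
    (exp (- eta) +
     Rpower eta beta *
       RInt_gen (fun s => Rpower s (- beta) * exp (- s))
         (at_right 0) (at_point eta)).

Definition is_min_01 (h : R -> R) (K : R) : Prop :=
  (exists eta, 0 < eta < 1 /\ h eta = K) /\
  (forall eta, 0 < eta < 1 -> K <= h eta).

(* Main.v *)
Require Import Defs.
From Stdlib Require Import Reals Lra Lia Classical ClassicalEpsilon.
From Coquelicot Require Import Coquelicot.
Open Scope R_scope.

(** Every value [H_ beta eta] is at least 36/25, so everything follows from
    [1 <= L * T^(1-beta) * 36/25].  Formally, [v(t) = u(t + T/m) - u(t)] is
    periodic with mean zero and solves [v' + A v = g] with
    [|g| <= L |A^beta v|].  The cross term in
    [int |v'|^2 + int |A v|^2 = int |g|^2] vanishes, Wirtinger's inequality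
    controls [int |v|^2] by [int |v'|^2], and [|A^beta v|] is at most
    [(6/5) T^(1-beta)] times [|A v + (2/T) v|]; if the bound failed, these would
    force [v = 0] for every [m] and [u] would be constant.

    No regularity of [v] is needed when time is discretized with a step [h]
    dividing [T/m]: [A] becomes [(1 - e^(-hA)) / h], the energy identity becomes
    an exact identity for finite sums, and the error in [g] tends to [0] with
    [h].  The bound on [A^beta] comes from pairing
    [Gamma(beta) A^(-beta) y = int t^(beta-1) e^(-tA) y dt] with vectors
    [e^(-sA) y], which only uses that [e^(-tA)] is a symmetric contraction.

    Should [-A] have no semigroup, [semigroup A] is the junk value zero and
    every mild solution vanishes. *)

(** * Inner products and bounded linear maps *)

(** The number 36/25 sits between two thresholds. As [/ 3 <= M_ beta], the function [H_] dominates
    eta/(1-eta) + 1/(3 eta), whose minimum is about 1.488. The energy method forces constancy as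
    soon as (4/3) (6/5)^2 (L T^(1-beta))^2 < 1, that is, for L T^(1-beta) below about 1/1.386. With
    36/25 the contraction factor is 25/27, for every beta at once; the shift 2/T makes this
    possible, since through Wirtinger it costs only the factor 4/3.

    No spectral theorem is used. Positivity of the spectrum is first turned into positivity of the
    form of A, and this into contractivity of e^(-tA). The second step compares orbits over short
    times and needs a local bound on the norm of e^(-tA), which strong continuity gives only through
    uniform boundedness.

    The price of using the bounded operator s = e^(-hA) alone is that the inequalities control
    smoothed vectors: powers of s stay in front of v and of A^beta v until h tends to 0. *)

Lemma opp_scal {X : NormedModule R_AbsRing} (x : X) : opp x = scal (-1)%R x.
Proof. exact (eq_sym (scal_opp_one x)). Qed.

Lemma zero_scal {X : NormedModule R_AbsRing} (x : X) : (zero : X) = scal 0%R x.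
Proof. exact (eq_sym (scal_zero_l x)). Qed.

Section InnerProduct.
Context {X : NormedModule R_AbsRing} {ip : X -> X -> R}
  (Hip : is_inner_product ip).
Implicit Types x y z : X.

Lemma ip_sym x y : ip x y = ip y x.
Proof. apply Hip. Qed.

Lemma ip_plus_l x y z : ip (plus x y) z = ip x z + ip y z.
Proof. apply Hip. Qed.

Lemma ip_scal_l (a : R) x y : ip (scal a x) y = a * ip x y.
Proof. apply Hip. Qed.

Lemma ip_norm x : norm x ^ 2 = ip x x.
Proof. symmetry; apply Hip. Qed.

Lemma ip_plus_r x y z : ip z (plus x y) = ip z x + ip z y.
Proof. now rewrite ip_sym, ip_plus_l, 2!(ip_sym _ z). Qed.

Lemma ip_scal_r (a : R) x y : ip y (scal a x) = a * ip y x.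
Proof. now rewrite ip_sym, ip_scal_l, (ip_sym _ y). Qed.

Lemma ip_opp_l x y : ip (opp x) y = - ip x y.
Proof.
  rewrite opp_scal, ip_scal_l; ring.
Qed.

Lemma ip_opp_r x y : ip y (opp x) = - ip y x.
Proof. now rewrite ip_sym, ip_opp_l, (ip_sym _ y). Qed.

Lemma ip_minus_l x y z : ip (minus x y) z = ip x z - ip y z.
Proof. unfold minus; rewrite ip_plus_l, ip_opp_l; ring. Qed.

Lemma ip_minus_r x y z : ip z (minus x y) = ip z x - ip z y.
Proof. unfold minus; rewrite ip_plus_r, ip_opp_r; ring. Qed.

Lemma ip_zero_l x : ip zero x = 0.
Proof. rewrite (zero_scal x), ip_scal_l; ring. Qed.

Lemma ip_zero_r x : ip x zero = 0.
Proof. now rewrite ip_sym, ip_zero_l. Qed.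

Lemma ip_ge0 x : 0 <= ip x x.
Proof. rewrite <- ip_norm; apply pow2_ge_0. Qed.

Lemma ip_ext x y : (forall z, ip x z = ip y z) -> x = y.
Proof.
  intros H; apply plus_reg_r with (opp y); rewrite plus_opp_r.
  apply norm_eq_zero; change (norm (minus x y) = 0).
  assert (E := ip_norm (minus x y)).
  rewrite ip_minus_l, H in E.
  apply Rsqr_0_uniq; unfold Rsqr; simpl in E; lra.
Qed.

Lemma cauchy_schwarz x y : Rabs (ip x y) <= norm x * norm y.
Proof.
  assert (Hx := norm_ge_0 x); assert (Hy := norm_ge_0 y).
  destruct (Req_dec (norm y) 0) as [Hy0 | Hy0].
  - rewrite (norm_eq_zero _ Hy0), ip_zero_r, Rabs_R0, norm_zero; lra.
  -     assert (H := ip_ge0 (minus (scal (norm y ^ 2) x) (scal (ip x y) y))).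
    rewrite !ip_minus_l, !ip_minus_r, !ip_scal_l, !ip_scal_r, <- !ip_norm,
      (ip_sym y x) in H.
    assert (Hp : 0 < norm y ^ 2) by (assert (0 < norm y) by lra; nra).
    assert (ip x y ^ 2 <= (norm x * norm y) ^ 2).
    { apply Rmult_le_reg_l with (norm y ^ 2); [assumption | nra]. }
    apply Rsqr_incr_0_var; [ | nra].
    rewrite <- Rsqr_abs; unfold Rsqr; nra.
Qed.

Lemma ip_le_norm x y : ip x y <= norm x * norm y.
Proof. eapply Rle_trans; [apply Rle_abs | apply cauchy_schwarz]. Qed.

End InnerProduct.

Ltac ip_expand H :=
  repeat first
    [ rewrite (ip_minus_l H) | rewrite (ip_minus_r H) | rewrite (ip_plus_l H)
    | rewrite (ip_plus_r H) | rewrite (ip_scal_l H) | rewrite (ip_scal_r H)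
    | rewrite (ip_opp_l H) | rewrite (ip_opp_r H) | rewrite (ip_zero_l H)
    | rewrite (ip_zero_r H) ].

(** Vector identities are proved weakly: pairing both sides with an arbitrary [z] leaves an identity
    between real numbers for [ring] or [field]. *)
Ltac ip_eq H := apply (ip_ext H); let z := fresh "z" in intro z; ip_expand H.

Section Normed.
Context {U V : NormedModule R_AbsRing}.
Implicit Types x y : U.

Lemma Riemann_sum_linear (l : U -> V) (f : R -> U) ptd :
  is_linear l -> Riemann_sum (fun t => l (f t)) ptd = l (Riemann_sum f ptd).
Proof.
  intros Hl; induction ptd using SF_cons_ind.
  - exact (eq_sym (linear_zero l Hl)).
  - rewrite !Riemann_sum_cons, (linear_plus l Hl), (linear_scal l Hl).
    now f_equal.
Qed.

Lemma is_RInt_linear (l : U -> V) (f : R -> U) a b I :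
  is_linear l -> is_RInt f a b I -> is_RInt (fun t => l (f t)) a b (l I).
Proof.
  intros Hl Hf; unfold is_RInt in *.
  assert (Hc := filterlim_comp _ _ _ _ l _ _ _ Hf (linear_cont l I Hl)).
  eapply filterlim_ext; [ | exact Hc].
  intros ptd; cbv beta.
  now rewrite (linear_scal l Hl), Riemann_sum_linear.
Qed.

Lemma at_right_0_norm (f : R -> U) y :
  filterlim f (at_right 0) (locally y) <->
  forall eps, 0 < eps -> exists d, 0 < d /\
    forall t, 0 < t < d -> norm (minus (f t) y) < eps.
Proof.
  rewrite filterlim_locally_ball_norm; split; intros H eps.
  - intros He; destruct (H (mkposreal _ He)) as [d Hd].
    exists d; split; [apply cond_pos | intros t Ht].
    apply Hd; [ | lra].
    change (Rabs (t - 0) < d); rewrite Rabs_pos_eq; lra.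
  - destruct (H eps (cond_pos eps)) as [d [Hd0 Hd]].
    exists (mkposreal d Hd0); intros t Ht Ht0; apply Hd.
    change (Rabs (t - 0) < d) in Ht; rewrite Rabs_pos_eq in Ht; lra.
Qed.

End Normed.

Lemma norm_minus_sym {X : NormedModule R_AbsRing} (x y : X) :
  norm (minus x y) = norm (minus y x).
Proof. rewrite <- (norm_opp (minus y x)), opp_minus; reflexivity. Qed.

Lemma norm_minus_le {X : NormedModule R_AbsRing} (x y z : X) :
  norm (minus x z) <= norm (minus x y) + norm (minus y z).
Proof. rewrite (minus_trans y); apply norm_triangle. Qed.

Lemma norm_scal_abs {X : NormedModule R_AbsRing} (a : R) (x : X) :
  norm (scal a x) = Rabs a * norm x.
Proof.
  apply Rle_antisym; [apply (norm_scal a x) | ].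
  destruct (Req_dec a 0) as [-> | Ha].
  - rewrite Rabs_R0, Rmult_0_l; apply norm_ge_0.
  - assert (E : x = scal (/ a) (scal a x)).
    { transitivity (scal (/ a * a) x); [ | exact (eq_sym (scal_assoc (/ a) a x))].
      rewrite Rinv_l by exact Ha; exact (eq_sym (scal_one x)). }
    assert (H : norm x <= / Rabs a * norm (scal a x)).
    { rewrite <- Rabs_inv; rewrite E at 1; apply (norm_scal (/ a) (scal a x)). }
    assert (Hp := Rabs_pos_lt a Ha).
    apply Rmult_le_reg_l with (/ Rabs a); [now apply Rinv_0_lt_compat | ].
    rewrite <- Rmult_assoc, Rinv_l, Rmult_1_l; lra.
Qed.

(** * Uniform boundedness *)

(** [M] is the operator norm, as a supremum over the unit ball. The vector in the hypothesis forces
    [c <= M], so [M] is positive and some unit-ball value reaches [3 / 4 * M]. *)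
Lemma norming_vector {U V : NormedModule R_AbsRing} (T : U -> V) (c : R) :
  is_linear T -> 0 < c -> (exists x, c * norm x < norm (T x)) ->
  exists M z, c <= M /\ (forall x, norm (T x) <= M * norm x) /\
    norm z <= 1 /\ 3 / 4 * M <= norm (T z).
Proof.
  intros HT Hc [x0 Hx0].
  destruct (linear_norm T HT) as [K [HK HTK]].
  set (E := fun r => exists z : U, norm z <= 1 /\ r = norm (T z)).
  destruct (completeness E) as [M [HM1 HM2]].
  - exists K; intros r [z [Hz ->]].
    eapply Rle_trans; [apply HTK | ].
    assert (H := norm_ge_0 z); nra.
  - exists (norm (T zero)), zero; split; [rewrite norm_zero; lra | reflexivity].
  - assert (HTM : forall x, norm (T x) <= M * norm x).
    { intros x; destruct (Req_dec (norm x) 0) as [Hx | Hx].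
      - rewrite (norm_eq_zero _ Hx), (linear_zero T HT), !norm_zero; lra.
      - assert (Hp : 0 < norm x) by (assert (H := norm_ge_0 x); lra).
        assert (H : norm (T (scal (/ norm x) x)) <= M).
        { apply HM1; exists (scal (/ norm x) x); split; [ | reflexivity].
          rewrite norm_scal_abs, Rabs_pos_eq, Rinv_l;
            [lra | exact Hx | left; now apply Rinv_0_lt_compat]. }
        rewrite (linear_scal T HT), norm_scal_abs, Rabs_pos_eq in H
          by (left; now apply Rinv_0_lt_compat).
        apply Rmult_le_reg_l with (/ norm x); [now apply Rinv_0_lt_compat | ].
        replace (/ norm x * (M * norm x)) with M by (field; exact Hx).
        exact H. }
    assert (HcM : c <= M).
    { destruct (Rle_or_lt c M) as [H | H]; [exact H | exfalso].
      assert (H1 := HTM x0); assert (H2 := norm_ge_0 x0); nra. }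
    exists M.
    destruct (classic (exists z : U, norm z <= 1 /\ 3 / 4 * M <= norm (T z)))
      as [[z Hz] | Hn].
    + now exists z.
    + exfalso; apply (Rlt_not_le M (3 / 4 * M)); [lra | ].
      apply HM2; intros r [z [Hz ->]].
      destruct (Rle_or_lt (norm (T z)) (3 / 4 * M)) as [H | H]; [exact H | ].
      exfalso; apply Hn; exists z; split; [exact Hz | lra].
Qed.

Lemma minus_plus_l {G : AbelianGroup} (x y : G) : minus (plus x y) x = y.
Proof.
  change (plus (plus x y) (opp x) = y).
  rewrite (plus_comm x), <- plus_assoc, plus_opp_r; apply plus_zero_r.
Qed.

Lemma minus_plus_minus {G : AbelianGroup} (x y : G) :
  minus (plus x y) (minus x y) = plus y y.
Proof.
  change (plus (plus x y) (opp (plus x (opp y))) = plus y y).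
  rewrite opp_plus, opp_opp, (plus_comm x), <- plus_assoc, (plus_assoc x).
  now rewrite plus_opp_r, plus_zero_l.
Qed.

Lemma norm_double {V : NormedModule R_AbsRing} (x : V) :
  norm (plus x x) = 2 * norm x.
Proof.
  assert (E : plus x x = scal 2 x).
  { assert (E1 : scal 1 x = x) by exact (scal_one x).
    transitivity (plus (scal 1 x) (scal 1 x)); [now rewrite E1 | ].
    replace 2 with (1 + 1) by ring; exact (eq_sym (scal_distr_r 1 1 x)). }
  rewrite E, norm_scal_abs, Rabs_pos_eq; lra.
Qed.

(** The images of [x + a z] and [x - a z] differ by [2 a T z], so one of them has norm at least
    [a * b]. *)
Lemma perturb_large {U V : NormedModule R_AbsRing} (T : U -> V) (x z : U)
    (a b : R) :
  is_linear T -> 0 < a -> norm z <= 1 -> b <= norm (T z) ->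
  exists y, norm (minus y x) <= a /\ a * b <= norm (T y).
Proof.
  intros HT Ha Hz Hb.
  assert (Hs : norm (scal a z) <= a)
    by (rewrite norm_scal_abs, Rabs_pos_eq; nra).
  destruct (Rle_or_lt (a * b) (norm (T (plus x (scal a z))))) as [H | H].
  { exists (plus x (scal a z)); split; [ | exact H].
    rewrite (minus_plus_l x); exact Hs. }
  exists (minus x (scal a z)); split.
  { unfold minus at 2; rewrite (minus_plus_l x), norm_opp; exact Hs. }
  rewrite (linear_minus T _ _ HT), (linear_plus T HT), (linear_scal T HT) in *.
  change (norm (plus (T x) (scal a (T z))) < a * b) in H.
  change (a * b <= norm (minus (T x) (scal a (T z)))).
  assert (H1 : norm (minus (plus (T x) (scal a (T z)))
                      (minus (T x) (scal a (T z)))) = 2 * (a * norm (T z))).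
  { transitivity (norm (plus (scal a (T z)) (scal a (T z))));
      [apply f_equal; exact (minus_plus_minus (T x) (scal a (T z))) | ].
    etransitivity; [exact (norm_double (scal a (T z))) | ].
    rewrite norm_scal_abs, Rabs_pos_eq; lra. }
  assert (H2 : norm (minus (plus (T x) (scal a (T z)))
                      (minus (T x) (scal a (T z)))) <=
    norm (plus (T x) (scal a (T z))) + norm (minus (T x) (scal a (T z)))).
  { unfold minus at 1; eapply Rle_trans; [apply norm_triangle | ].
    rewrite norm_opp; lra. }
  assert (H3 : a * b <= a * norm (T z)) by (apply Rmult_le_compat_l; lra).
  rewrite H1 in H2; lra.
Qed.

(** Stating completeness as a property lets [X] remain a plain [NormedModule] in all sections; it is
    consumed only by the uniform boundedness principle. *)
Definition seq_complete (X : NormedModule R_AbsRing) : Prop :=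
  forall xs : nat -> X,
    (forall eps, 0 < eps -> exists N, forall n m, (N <= n)%nat -> (N <= m)%nat ->
      norm (minus (xs n) (xs m)) < eps) ->
    exists x, forall eps, 0 < eps -> exists N, forall n, (N <= n)%nat ->
      norm (minus (xs n) x) < eps.

Lemma CompleteNormedModule_seq_complete (X : CompleteNormedModule R_AbsRing) :
  seq_complete X.
Proof.
  intros xs Hxs.
  destruct (proj1 (filterlim_locally_cauchy (F := eventually) xs)) as [x Hx].
  - intros eps; destruct (Hxs eps (cond_pos eps)) as [N HN].
    exists (fun y => exists m, (N <= m)%nat /\ y = m); split.
    + now exists N; intros n Hn; exists n.
    + intros a b [m [Hm ->]] [m' [Hm' ->]]; apply (norm_compat1 (V := X)).
      exact (HN m' m Hm' Hm).
  - exists x; intros eps Heps.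
    exact (proj1 (filterlim_locally_ball_norm (U := X) xs x) Hx
      (mkposreal eps Heps)).
Qed.

(* Sokal's gliding-hump proof: [x] is the limit of a sequence whose [n]-th
   increment has norm at most [3^-n] and makes [T n] large, and the remaining
   increments are too small to undo this. *)
Lemma uniform_boundedness {U V : NormedModule R_AbsRing} (T : nat -> U -> V) :
  seq_complete U ->
  (forall n, is_linear (T n)) ->
  (forall n, exists x : U, 4 ^ n * norm x < norm (T n x)) ->
  exists x, forall n, / 4 * (4 / 3) ^ n <= norm (T n x).
Proof.
  intros Hcomplete HT Hbig.
  assert (Hstep : forall (n : nat) (x : U), exists y M,
    4 ^ n <= M /\ (forall x, norm (T n x) <= M * norm x) /\
    norm (minus y x) <= (1 / 3) ^ n /\ (1 / 3) ^ n * (3 / 4 * M) <= norm (T n y)).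
  { intros n x.
    destruct (norming_vector (T n) (4 ^ n)) as [M [z [HM [HTM [Hz HTz]]]]];
      [apply HT | apply pow_lt; lra | apply Hbig | ].
    destruct (perturb_large (T n) x z ((1 / 3) ^ n) (3 / 4 * M)) as [y [Hy1 Hy2]];
      [apply HT | apply pow_lt; lra | exact Hz | exact HTz | ].
    now exists y, M. }
  set (step := fun n x => proj1_sig (constructive_indefinite_description _ (Hstep n x))).
  assert (Hst : forall n x, exists M,
    4 ^ n <= M /\ (forall x, norm (T n x) <= M * norm x) /\
    norm (minus (step n x) x) <= (1 / 3) ^ n /\
    (1 / 3) ^ n * (3 / 4 * M) <= norm (T n (step n x))).
  { intros n x; exact (proj2_sig (constructive_indefinite_description _ (Hstep n x))). }
  clearbody step; clear Hstep.
  set (xs := fix xs n := match n with O => zero | S k => step k (xs k) end).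
  assert (Htail : forall n k,
    norm (minus (xs (n + k)%nat) (xs n)) <= 3 / 2 * (1 / 3) ^ n * (1 - (1 / 3) ^ k)).
  { intros n; induction k as [ | k IH].
    - rewrite Nat.add_0_r, minus_eq_zero.
      eapply Rle_trans; [right; exact norm_zero | simpl; lra].
    - rewrite Nat.add_succ_r.
      destruct (Hst (n + k)%nat (xs (n + k)%nat)) as [M [_ [_ [H _]]]].
      change (step (n + k)%nat (xs (n + k)%nat)) with (xs (S (n + k))) in H.
      eapply Rle_trans; [apply (norm_minus_le _ (xs (n + k)%nat)) | ].
      rewrite pow_add in H; rewrite <- tech_pow_Rmult; lra. }
  assert (H3 : forall n, 0 < (1 / 3) ^ n) by (intro; apply pow_lt; lra).
  assert (Htail' : forall n m, (n <= m)%nat ->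
    norm (minus (xs m) (xs n)) <= 3 / 2 * (1 / 3) ^ n).
  { intros n m Hnm; replace m with (n + (m - n))%nat by lia.
    eapply Rle_trans; [apply Htail | ].
    assert (H := H3 (m - n)%nat); assert (H' := H3 n); nra. }
  destruct (Hcomplete xs) as [x Hx].
  { intros eps Heps.
    destruct (pow_lt_1_zero (1 / 3)) with (y := eps / 4) as [N HN];
      [rewrite Rabs_pos_eq; lra | lra | ].
    assert (HNN := HN N (le_n N)); rewrite Rabs_pos_eq in HNN by (left; apply H3).
    exists N; intros m m' Hm Hm'.
    eapply Rle_lt_trans; [apply (norm_minus_le _ (xs N)) | ].
    rewrite (norm_minus_sym (xs N)).
    assert (H1 := Htail' N m Hm); assert (H2 := Htail' N m' Hm'); lra. }
  assert (Hlim : forall n, norm (minus x (xs n)) <= 3 / 2 * (1 / 3) ^ n).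
  { intros n; apply Rnot_lt_le; intros Hlt.
    destruct (Hx _ (proj2 (Rlt_0_minus _ _) Hlt)) as [N HN].
    assert (H1 := HN (n + N)%nat ltac:(lia)).
    assert (H2 := Htail' n (n + N)%nat ltac:(lia)).
    rewrite norm_minus_sym in H1.
    assert (H4 := norm_minus_le x (xs (n + N)%nat) (xs n)); lra. }
  exists x; intros n.
  destruct (Hst n (xs n)) as [M [HM [HTM [_ H]]]].
  change (step n (xs n)) with (xs (S n)) in H.
  assert (H1 := Hlim (S n)); assert (H2 := HTM (minus x (xs (S n)))).
  rewrite (linear_minus (T n) x (xs (S n)) (HT n)) in H2.
  assert (H4 := norm_triangle_inv (T n x) (T n (xs (S n)))).
  apply Rabs_le_between in H4.
  assert (Hp := H3 n); assert (Hp4 : 0 < 4 ^ n) by (apply pow_lt; lra).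
  assert (E : (4 / 3) ^ n = 4 ^ n * (1 / 3) ^ n)
    by (rewrite <- Rpow_mult_distr; apply f_equal2; [lra | reflexivity]).
  rewrite E; rewrite <- tech_pow_Rmult in H1.
  (* The increments after stage [n] add up to at most half of [3^-n]. They cost [M / 2] out of the
     [3 / 4 * M] gained at that stage, and the remaining quarter is compared with [4 ^ n <= M]. *)
  assert (H5 : M * norm (minus x (xs (S n))) <= M * (1 / 2 * (1 / 3) ^ n))
    by (apply Rmult_le_compat_l; lra).
  assert (H6 : 4 ^ n * (1 / 3) ^ n <= M * (1 / 3) ^ n)
    by (apply Rmult_le_compat_r; lra).
  lra.
Qed.

(** * Positivity of the quadratic form of A *)

Section SelfAdjoint.
Context {X : NormedModule R_AbsRing} {ip : X -> X -> R}
  (Hip : is_inner_product ip) {A : operator X}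
  (Hsa : self_adjoint ip A) (Hpos : positive_operator A).

Lemma self_adjoint_sym x y :
  dom A x -> dom A y -> ip (app A x) y = ip x (app A y).
Proof.
  intros Hx Hy; exact (proj2 (proj2 Hsa y (app A y)) (conj Hy eq_refl) x Hx).
Qed.

Lemma positive_resolvent l : l <= 0 -> resolvent_set A l.
Proof.
  intros Hl; apply NNPP; intros H.
  assert (H0 := Hpos l H); lra.
Qed.

(* The infimum of the numerical range of [B = A^-1] is nonnegative: a negative
   infimum [m] would make [B - m] nonnegative, while the resolvent of [A] at
   [1 / m] bounds [B - m] below, so that [m] could be increased. *)
Lemma positive_form x : dom A x -> 0 <= ip (app A x) x.
Proof.
  intros Hx.
  destruct (positive_resolvent 0 (Rle_refl 0)) as [B [HB [HAB HBA]]].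
  assert (HAB' : forall y, app A (B y) = y).
  { intros y; rewrite <- (proj2 (HAB y)) at 2.
    ip_eq Hip; ring. }
  assert (HBA' : B (app A x) = x).
  { rewrite <- (HBA x Hx) at 2; f_equal; ip_eq Hip; ring. }
  assert (Bsym : forall y z, ip (B y) z = ip y (B z)).
  { intros y z; rewrite <- (HAB' z) at 1; rewrite <- (HAB' y) at 2.
    symmetry; apply self_adjoint_sym; apply HAB. }
  destruct (linear_norm B HB) as [K [HK HBK]].
  (* The cap [r <= 0] keeps the set bounded above even if [X] is the zero space, and a supremum
     equal to [0] is exactly nonnegativity of [B]. *)
  set (E := fun r => r <= 0 /\ forall y, 0 <= ip (B y) y - r * ip y y).
  destruct (completeness E) as [m [Hm1 Hm2]].
  { exists 0; intros r [Hr _]; exact Hr. }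
  { exists (- K); split; [lra | intros y].
    assert (H := cauchy_schwarz Hip (B y) y); apply Rabs_le_between in H.
    assert (H1 := HBK y); assert (H2 := norm_ge_0 y).
    rewrite <- (ip_norm Hip y); nra. }
  assert (Hm0 : m <= 0) by (apply Hm2; intros r [Hr _]; exact Hr).
  assert (HmE : forall y, 0 <= ip (B y) y - m * ip y y).
  { intros y; apply Rnot_lt_le; intros Hy.
    assert (Hyy : 0 < ip y y).
    { destruct (Rle_lt_or_eq_dec _ _ (ip_ge0 Hip y)) as [H | H]; [exact H | ].
      assert (H1 : norm y = 0).
      { assert (H2 := ip_norm Hip y); apply Rsqr_0_uniq; unfold Rsqr; nra. }
      rewrite (norm_eq_zero _ H1), !(ip_zero_r Hip) in Hy; lra. }
    apply (Rlt_not_le m (ip (B y) y / ip y y)).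
    - apply Rmult_lt_reg_r with (ip y y); [exact Hyy | ].
      unfold Rdiv; rewrite Rmult_assoc, Rinv_l; lra.
    - apply Hm2; intros r [_ Hr]; assert (H := Hr y).
      apply Rmult_le_reg_r with (ip y y); [exact Hyy | ].
      unfold Rdiv; rewrite Rmult_assoc, Rinv_l; lra. }
  destruct (Rle_lt_or_eq_dec _ _ Hm0) as [Hm | ->]; cycle 1.
  { assert (H := HmE (app A x)); rewrite HBA' in H.
    rewrite (ip_sym Hip); lra. }
  exfalso.
  destruct (positive_resolvent (/ m)) as [Q [HQ [_ HQA]]].
  { left; now apply Rinv_lt_0_compat. }
  destruct (linear_norm Q HQ) as [KQ [HKQ HQn]].
  set (P := fun y => minus (B y) (scal m y)).
  (* Since [(A - 1/m) B y = y - (1/m) B y = -(1/m) P y], the resolvent bounds [B y] by [P y]; then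
     [y], a combination of [B y] and [P y], is bounded as well. *)
  assert (HP : forall y, norm y <= (KQ * / m ^ 2 + - / m) * norm (P y)).
  { intros y.
    assert (E1 : B y = Q (scal (- / m) (P y))).
    { rewrite <- (HQA (B y) (proj1 (HAB y))) at 1; f_equal.
      rewrite HAB'; unfold P; ip_eq Hip; field; lra. }
    assert (E2 : y = scal (- / m) (minus (P y) (B y))).
    { unfold P; ip_eq Hip; field; lra. }
    assert (H1 : norm (B y) <= KQ * (- / m * norm (P y))).
    { rewrite E1 at 1; eapply Rle_trans; [apply HQn | ].
      rewrite norm_scal_abs, Rabs_pos_eq; [lra | ].
      assert (H := Rinv_lt_0_compat m Hm); lra. }
    assert (H2 : norm y = - / m * norm (minus (P y) (B y))).
    { rewrite E2 at 1; rewrite norm_scal_abs, Rabs_pos_eq; [lra | ].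
      assert (H := Rinv_lt_0_compat m Hm); lra. }
    assert (H3 : norm (minus (P y) (B y)) <= norm (P y) + norm (B y)).
    { unfold minus; rewrite <- (norm_opp (B y)); apply norm_triangle. }
    rewrite H2; replace (/ m ^ 2) with (- / m * - / m) by (field; lra).
    assert (H := Rinv_lt_0_compat m Hm); nra. }
  set (k := KQ * / m ^ 2 + - / m) in HP.
  assert (Hk : 0 < k).
  { assert (H := Rinv_lt_0_compat m Hm); unfold k.
    assert (0 < / m ^ 2) by (apply Rinv_0_lt_compat; nra); nra. }
  set (N := K - m).
  assert (HN : 0 < N) by (unfold N; lra).
  assert (HPN : forall y, norm (P y) <= N * norm y).
  { intros y; unfold P, minus, N; eapply Rle_trans; [apply norm_triangle | ].
    rewrite norm_opp, norm_scal_abs, Rabs_left by exact Hm.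
    assert (H := HBK y); lra. }
  (* This is [P^2 <= N P] for a nonnegative symmetric [P] of norm at most [N], obtained by testing
     nonnegativity of the form of [P] at [y - P y / N]. *)
  assert (HPk : forall y, norm (P y) ^ 2 <= N * ip (P y) y).
  { intros y.
    assert (H := HmE (minus y (scal (/ N) (P y)))).
    rewrite (linear_minus B _ _ HB), (linear_scal B HB) in H.
    revert H; ip_expand Hip; intros H.
    assert (H1 : ip (P (P y)) (P y) <= N * norm (P y) ^ 2).
    { eapply Rle_trans; [apply (ip_le_norm Hip) | ].
      assert (H1 := HPN (P y)); assert (H2 := norm_ge_0 (P y)); nra. }
    rewrite (ip_norm Hip) in *.
    assert (E1 : ip (P (P y)) (P y) = ip (B (P y)) (P y) - m * ip (P y) (P y)).
    { unfold P at 1; ip_expand Hip; reflexivity. }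
    assert (E2 : ip (P y) (P y) = ip (B y) (P y) - m * ip y (P y)).
    { unfold P at 1; ip_expand Hip; reflexivity. }
    assert (E3 : ip (P y) y = ip (B y) y - m * ip y y).
    { unfold P at 1; ip_expand Hip; reflexivity. }
    rewrite (Bsym (P y) y), (ip_sym Hip (P y) (B y)), (ip_sym Hip (P y) y) in H.
    apply Rmult_le_reg_l with (/ N); [now apply Rinv_0_lt_compat | ].
    replace (/ N * (N * ip (P y) y)) with (ip (P y) y) by (field; lra).
    assert (H2 : / N * / N * ip (P (P y)) (P y) <= / N * ip (P y) (P y)).
    { assert (Hi := Rinv_0_lt_compat N HN).
      replace (/ N * ip (P y) (P y)) with (/ N * / N * (N * ip (P y) (P y)))
        by (field; lra).
      apply Rmult_le_compat_l; [nra | exact H1]. }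
    nra. }
  (* [HP] and [HPk] give [|y|^2 <= k^2 N <P y, y>], so the lower bound [m] of the form of [B] can be
     raised by [1 / (k^2 N)], up to the cap [0]. *)
  set (r := Rmin 0 (m + / (k ^ 2 * N))).
  assert (HkN : 0 < k ^ 2 * N)
    by (apply Rmult_lt_0_compat; [now apply pow_lt | exact HN]).
  assert (Hd : 0 < / (k ^ 2 * N)) by now apply Rinv_0_lt_compat.
  apply (Rlt_not_le r m); [unfold r, Rmin; destruct Rle_dec; lra | ].
  apply Hm1; split; [apply Rmin_l | intros y].
  assert (H1 := HPk y); assert (H2 := HP y).
  assert (E3 : ip (P y) y = ip (B y) y - m * ip y y).
  { unfold P at 1; ip_expand Hip; reflexivity. }
  assert (H3 : norm y ^ 2 <= k ^ 2 * norm (P y) ^ 2).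
  { rewrite <- Rpow_mult_distr; apply pow_incr; split; [apply norm_ge_0 | exact H2]. }
  assert (H4 : / (k ^ 2 * N) * norm y ^ 2 <= ip (P y) y).
  { apply Rmult_le_reg_l with (k ^ 2 * N); [exact HkN | ].
    rewrite <- Rmult_assoc, Rinv_r by lra.
    assert (H4 : 0 < k ^ 2) by now apply pow_lt.
    assert (H := Rmult_le_compat_l _ _ _ (Rlt_le _ _ H4) H1); lra. }
  assert (H5 : r <= m + / (k ^ 2 * N)) by apply Rmin_r.
  rewrite (ip_norm Hip) in H4; assert (H6 := ip_ge0 Hip y); nra.
Qed.

End SelfAdjoint.

(** * The semigroup is a symmetric contraction *)

Section C0.
Context {X : NormedModule R_AbsRing} {S : R -> X -> X} (HS : C0_semigroup S).

Lemma C0_linear t : 0 <= t -> is_linear (S t).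
Proof. apply HS. Qed.

Lemma C0_zero x : S 0 x = x.
Proof. apply HS. Qed.

Lemma C0_plus s t x : 0 <= s -> 0 <= t -> S (s + t) x = S s (S t x).
Proof. apply HS. Qed.

Lemma C0_comm s t x : 0 <= s -> 0 <= t -> S s (S t x) = S t (S s x).
Proof. intros Hs Ht; rewrite <- !C0_plus by assumption; now rewrite Rplus_comm. Qed.

Lemma C0_cont0 x eps : 0 < eps ->
  exists d, 0 < d /\ forall t, 0 <= t < d -> norm (minus (S t x) x) < eps.
Proof.
  intros He.
  destruct (proj1 (at_right_0_norm (fun t => S t x) x) (proj2 (proj2 (proj2 HS)) x)
    eps He) as [d [Hd H]].
  exists d; split; [exact Hd | intros t [[Ht | <-] Htd]]; [apply H; lra | ].
  rewrite C0_zero, minus_eq_zero.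
  eapply Rle_lt_trans; [right; exact norm_zero | exact He].
Qed.

(** Otherwise there are times [tn n] tending to [0] at which the operator norm exceeds [4 ^ n].
    Uniform boundedness yields one [x] with unbounded [S (tn n) x], against strong continuity at
    [0]. *)
Lemma C0_bound_near_0 : seq_complete X ->
  exists d M, 0 < d /\ 1 <= M /\
    forall t x, 0 <= t <= d -> norm (S t x) <= M * norm x.
Proof.
  intros Hc; apply NNPP; intros Hn.
  assert (Hbad : forall n : nat, exists t, (0 <= t <= / (INR n + 1)) /\
    exists x, 4 ^ n * norm x < norm (S t x)).
  { intros n; apply NNPP; intros Hn'; apply Hn.
    assert (Hp : 0 < INR n + 1) by (assert (H := pos_INR n); lra).
    exists (/ (INR n + 1)), (4 ^ n).
    split; [now apply Rinv_0_lt_compat | split; [apply pow_R1_Rle; lra | ]].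
    intros t x Ht; apply Rnot_lt_le; intros Hlt; apply Hn'.
    exists t; split; [exact Ht | now exists x]. }
  set (tn := fun n => proj1_sig (constructive_indefinite_description _ (Hbad n))).
  assert (Htn : forall n, (0 <= tn n <= / (INR n + 1)) /\
    exists x, 4 ^ n * norm x < norm (S (tn n) x))
    by (intros n; exact (proj2_sig (constructive_indefinite_description _ (Hbad n)))).
  clearbody tn.
  destruct (uniform_boundedness (fun n => S (tn n)) Hc) as [x Hx];
    [intros n; apply C0_linear, Htn | apply Htn | ].
  destruct (C0_cont0 x 1) as [d [Hd Hcont]]; [lra | ].
  destruct (Pow_x_infinity (4 / 3)) with (b := 4 * (norm x + 1)) as [N1 HN1].
  { rewrite Rabs_pos_eq; lra. }
  destruct (archimed_cor1 d Hd) as [N2 [HN2 HN2']].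
  set (n := Nat.max N1 N2).
  assert (H1 := HN1 n ltac:(unfold n; lia)).
  rewrite Rabs_pos_eq in H1 by (apply pow_le; lra).
  assert (H2 : tn n < d).
  { eapply Rle_lt_trans; [apply Htn | ].
    eapply Rle_lt_trans; [ | exact HN2].
    apply Rinv_le_contravar; [now apply lt_0_INR | ].
    assert (INR N2 <= INR n) by (apply le_INR; unfold n; lia); lra. }
  assert (H3 := Hcont (tn n) (conj (proj1 (proj1 (Htn n))) H2)).
  assert (H4 := norm_triangle_inv (S (tn n) x) x); apply Rabs_le_between in H4.
  assert (H5 := Hx n); simpl in H5; lra.
Qed.

Lemma C0_bound_multiple d M n s x :
  (forall t x, 0 <= t <= d -> norm (S t x) <= M * norm x) -> 0 <= M ->
  0 <= s <= d -> norm (S (INR n * s) x) <= M ^ n * norm x.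
Proof.
  intros HM HM0 Hs; induction n as [ | n IH].
  - simpl; rewrite Rmult_0_l, C0_zero; lra.
  - rewrite S_INR; replace ((INR n + 1) * s) with (s + INR n * s) by ring.
    rewrite C0_plus; [ | lra | assert (H := pos_INR n); nra].
    eapply Rle_trans; [apply HM, Hs | simpl; nra].
Qed.

Lemma C0_bound tau : seq_complete X -> 0 < tau ->
  exists M, 1 <= M /\ forall t x, 0 <= t <= tau -> norm (S t x) <= M * norm x.
Proof.
  intros Hc Htau.
  destruct (C0_bound_near_0 Hc) as [d [M [Hd [HM HSM]]]].
  destruct (archimed_cor1 (d / tau)) as [n [Hn1 Hn2]];
    [now apply Rdiv_lt_0_compat | ].
  assert (Hn : 0 < INR n) by now apply lt_0_INR.
  exists (M ^ n); split; [apply pow_R1_Rle, HM | intros t x Ht].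
  replace t with (INR n * (t / INR n)) by (field; lra).
  apply C0_bound_multiple with d; [exact HSM | lra | ].
  assert (Hi : 0 < / INR n) by now apply Rinv_0_lt_compat.
  assert (H : / INR n * tau < d / tau * tau) by (apply Rmult_lt_compat_r; lra).
  replace (d / tau * tau) with d in H by (field; lra).
  unfold Rdiv; nra.
Qed.

End C0.

(** A mean value inequality without derivatives: over [n] equal steps the errors [eta * h] add up to
    [eta * t], and [eta] is arbitrary. *)
Lemma telescope_le (F : R -> R) (t : R) :
  0 <= t ->
  (forall eta, 0 < eta -> exists d, 0 < d /\ forall s h,
     0 < h < d -> 0 <= s -> s + h <= t -> F (s + h) <= F s + eta * h) ->
  F t <= F 0.
Proof.
  intros [Ht | <-] H; [ | lra].
  apply Rnot_lt_le; intros Hlt.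
  destruct (H ((F t - F 0) / (2 * t))) as [d [Hd Hstep]].
  { apply Rdiv_lt_0_compat; lra. }
  set (eta := (F t - F 0) / (2 * t)) in Hstep.
  assert (Heta : eta * t = (F t - F 0) / 2) by (unfold eta; field; lra).
  destruct (archimed_cor1 (d / t)) as [n [Hn1 Hn2]];
    [now apply Rdiv_lt_0_compat | ].
  assert (Hn : 0 < INR n) by now apply lt_0_INR.
  set (h := t / INR n).
  assert (Hh : 0 < h) by now apply Rdiv_lt_0_compat.
  assert (Hhn : INR n * h = t) by (unfold h; field; lra).
  assert (Hhd : h < d).
  { unfold h, Rdiv; apply (Rmult_lt_compat_l t) in Hn1; [ | exact Ht].
    replace (t * (d / t)) with d in Hn1 by (field; lra); exact Hn1. }
  assert (Hind : forall k, (k <= n)%nat ->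
    F (INR k * h) <= F 0 + eta * (INR k * h)).
  { induction k as [ | k IH]; intros Hk.
    - simpl; rewrite Rmult_0_l; lra.
    - rewrite S_INR; replace ((INR k + 1) * h) with (INR k * h + h) by ring.
      assert (H1 : INR k + 1 <= INR n)
        by (rewrite <- S_INR; apply le_INR; exact Hk).
      assert (H2 := pos_INR k).
      eapply Rle_trans; [apply Hstep; [lra | nra | nra] | ].
      assert (H3 := IH ltac:(lia)); lra. }
  assert (Hfin := Hind n (le_n n)); rewrite Hhn in Hfin; lra.
Qed.

Section Generated.
Context {X : NormedModule R_AbsRing} {ip : X -> X -> R}
  (Hip : is_inner_product ip) (Hc : seq_complete X) {A : operator X}
  (Hsa : self_adjoint ip A) (Hpos : positive_operator A)
  {S : R -> X -> X} (HS : generated_by_opp A S).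

Let HC0 : C0_semigroup S := proj1 HS.

Lemma semigroup_generator t x : 0 <= t -> dom A x ->
  dom A (S t x) /\ app A (S t x) = S t (app A x).
Proof.
  intros Ht Hx.
  assert (HSt := C0_linear HC0 t Ht).
  assert (Hg := proj2 (proj2 HS x (opp (app A x))) (conj Hx eq_refl)).
  assert (Hg' : generator_graph S (S t x) (S t (opp (app A x)))).
  { eapply filterlim_within_ext; cycle 1.
    - exact (filterlim_comp _ _ _ _ (S t) _ _ _ Hg (linear_cont _ _ HSt)).
    - intros h Hh; cbv beta; rewrite (linear_scal _ HSt), (linear_minus _ _ _ HSt).
      rewrite (C0_comm HC0 t h); [reflexivity | exact Ht | lra]. }
  destruct (proj1 (proj2 HS _ _) Hg') as [H1 H2].
  split; [exact H1 | ].
  rewrite (linear_opp _ _ HSt) in H2.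
  apply (ip_ext Hip); intros z; apply (f_equal (fun w => ip w z)) in H2.
  rewrite !(ip_opp_l Hip) in H2; lra.
Qed.

Lemma semigroup_expand x eps : dom A x -> 0 < eps ->
  exists d, 0 < d /\ forall h, 0 < h < d ->
    norm (plus (minus (S h x) x) (scal h (app A x))) <= eps * h.
Proof.
  intros Hx He.
  assert (Hg := proj2 (proj2 HS x (opp (app A x))) (conj Hx eq_refl)).
  destruct (proj1 (at_right_0_norm _ _) Hg eps He) as [d [Hd H]].
  exists d; split; [exact Hd | intros h Hh].
  assert (H1 := H h Hh).
  replace (plus (minus (S h x) x) (scal h (app A x))) with
    (scal h (minus (scal (/ h) (minus (S h x) x)) (opp (app A x)))).
  - rewrite norm_scal_abs, Rabs_pos_eq, Rmult_comm by lra.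
    apply Rmult_le_compat_r; [lra | left; exact H1].
  - ip_eq Hip; field; lra.
Qed.

(** [S s] commutes with [S h] and with [A], so the expansion at [S s x] is the image under [S s] of
    the one at [x], and [S s] is bounded uniformly on [[0, t]]. *)
Lemma semigroup_expand_unif x t eps : dom A x -> 0 < t -> 0 < eps ->
  exists d, 0 < d /\ forall h s, 0 < h < d -> 0 <= s <= t ->
    norm (plus (minus (S h (S s x)) (S s x)) (scal h (app A (S s x)))) <= eps * h.
Proof.
  intros Hx Ht He.
  destruct (C0_bound HC0 t Hc Ht) as [M [HM HSM]].
  destruct (semigroup_expand x (eps / M) Hx) as [d [Hd H]];
    [apply Rdiv_lt_0_compat; lra | ].
  exists d; split; [exact Hd | intros h s Hh Hs].
  assert (HSs := C0_linear HC0 s (proj1 Hs)).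
  rewrite (proj2 (semigroup_generator s x (proj1 Hs) Hx)).
  rewrite (C0_comm HC0 h s) by lra.
  rewrite <- (linear_minus _ _ _ HSs), <- (linear_scal _ HSs).
  rewrite <- (linear_plus _ HSs).
  eapply Rle_trans; [apply HSM, Hs | ].
  assert (H1 := H h Hh).
  apply (Rmult_le_compat_l M) in H1; [ | lra].
  replace (M * (eps / M * h)) with (eps * h) in H1 by (field; lra); exact H1.
Qed.

(** Formally the derivative of [|S(s) x|^2] is [-2 <A z, z> <= 0] with [z = S(s) x]. The choice of
    [eps] makes the remainder linear in [e] at most [eta h / 2], and the bound on [h] does the same
    for the quadratic one. *)
Lemma semigroup_contraction_dom t x : 0 <= t -> dom A x ->
  norm (S t x) ^ 2 <= norm x ^ 2.
Proof.
  intros Ht Hx.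
  rewrite <- (C0_zero HC0 x) at 2.
  apply (telescope_le (fun s => norm (S s x) ^ 2) t Ht).
  intros eta Heta.
  destruct Ht as [Ht | <-]; [ | exists 1; split; [lra | intros; lra]].
  destruct (C0_bound HC0 t Hc Ht) as [M [HM HSM]].
  set (a := M * norm x); set (b := M * norm (app A x)).
  assert (Ha : 0 <= a) by (assert (H := norm_ge_0 x); unfold a; nra).
  assert (Hb : 0 <= b) by (assert (H := norm_ge_0 (app A x)); unfold b; nra).
  set (eps := eta / (4 * (a + 1))).
  assert (Heps : 0 < eps) by (apply Rdiv_lt_0_compat; lra).
  assert (Hea : eps * (4 * (a + 1)) = eta) by (unfold eps; field; lra).
  destruct (semigroup_expand_unif x t eps Hx Ht Heps) as [d [Hd H]].
  exists (Rmin d (eta / (2 * (b + eps) ^ 2))).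
  assert (Hbe : 0 < (b + eps) ^ 2) by (apply pow_lt; lra).
  split; [apply Rmin_pos; [exact Hd | apply Rdiv_lt_0_compat; lra] | ].
  intros s h [Hh1 Hh2] Hs Hsh.
  assert (Hhd : h < d) by (eapply Rlt_le_trans; [exact Hh2 | apply Rmin_l]).
  assert (Hhe : h * (2 * (b + eps) ^ 2) < eta).
  { apply Rlt_le_trans with (eta / (2 * (b + eps) ^ 2) * (2 * (b + eps) ^ 2)).
    - apply Rmult_lt_compat_r; [lra | ].
      eapply Rlt_le_trans; [exact Hh2 | apply Rmin_r].
    - right; field; lra. }
  rewrite Rplus_comm, (C0_plus HC0) by lra.
  assert (H1 := H h s (conj Hh1 Hhd) ltac:(lra)).
  destruct (semigroup_generator s x Hs Hx) as [Hdz HAz].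
  set (z := S s x) in *.
  set (e := plus (minus (S h z) z) (scal h (app A z))) in H1.
  assert (Hz : norm z <= a) by (apply HSM; lra).
  assert (HAzb : norm (app A z) <= b) by (rewrite HAz; apply HSM; lra).
  assert (Hw : norm (minus (S h z) z) <= h * (b + eps)).
  { replace (minus (S h z) z) with (minus e (scal h (app A z)))
      by (unfold e; ip_eq Hip; ring).
    unfold minus; eapply Rle_trans; [apply norm_triangle | ].
    rewrite norm_opp, norm_scal_abs, Rabs_pos_eq by lra; nra. }
  assert (Hp := positive_form Hip Hsa Hpos z Hdz).
  assert (Hez := ip_le_norm Hip e z).
  assert (Hez' : norm e * norm z <= eps * h * a).
  { apply Rmult_le_compat; [apply norm_ge_0 | apply norm_ge_0 | exact H1 | exact Hz]. }
  assert (E : norm (S h z) ^ 2 = norm z ^ 2 + 2 * ip e z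
     - 2 * h * ip (app A z) z + norm (minus (S h z) z) ^ 2).
  { unfold e; rewrite !(ip_norm Hip); ip_expand Hip.
    rewrite (ip_sym Hip z (S h z)); ring. }
  assert (Hw2 : norm (minus (S h z) z) ^ 2 <= h ^ 2 * (b + eps) ^ 2).
  { rewrite <- Rpow_mult_distr; apply pow_incr; split; [apply norm_ge_0 | exact Hw]. }
  assert (Hw3 : h ^ 2 * (b + eps) ^ 2 <= h * eta / 2).
  { replace (h ^ 2 * (b + eps) ^ 2) with (h * (h * (b + eps) ^ 2)) by ring.
    replace (h * eta / 2) with (h * (eta / 2)) by field.
    apply Rmult_le_compat_l; lra. }
  assert (H5 : 2 * (eps * h * a) <= h * eta / 2).
  { rewrite <- Hea; nra. }
  assert (H6 : 0 <= h * ip (app A z) z) by (apply Rmult_le_pos; lra).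
  lra.
Qed.

(** By symmetry of [A] the function [s -> <S(t-s) x, S(s) y>] has zero derivative. [telescope_le]
    yields one inequality between its end values; exchanging [x] and [y] gives the other. *)
Lemma semigroup_sym_le t x y : 0 <= t -> dom A x -> dom A y ->
  ip x (S t y) <= ip (S t x) y.
Proof.
  intros Ht Hx Hy.
  assert (H := telescope_le (fun s => ip (S (t - s) x) (S s y)) t Ht).
  cbv beta in H; rewrite Rminus_diag, Rminus_0_r, !(C0_zero HC0) in H.
  apply H; clear H.
  intros eta Heta.
  destruct Ht as [Ht | <-]; [ | exists 1; split; [lra | intros; lra]].
  destruct (C0_bound HC0 t Hc Ht) as [M [HM HSM]].
  set (a := M * norm x); set (b := M * norm y).
  assert (Ha : 0 <= a) by (assert (H := norm_ge_0 x); unfold a; nra).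
  assert (Hb : 0 <= b) by (assert (H := norm_ge_0 y); unfold b; nra).
  set (eps := eta / (a + b + 1)).
  assert (Heps : 0 < eps) by (apply Rdiv_lt_0_compat; lra).
  assert (Hea : eps * (a + b + 1) = eta) by (unfold eps; field; lra).
  destruct (semigroup_expand_unif x t eps Hx Ht Heps) as [d1 [Hd1 H1]].
  destruct (semigroup_expand_unif y t eps Hy Ht Heps) as [d2 [Hd2 H2]].
  exists (Rmin d1 d2); split; [now apply Rmin_pos | ].
  intros s h [Hh1 Hh2] Hs Hsh.
  assert (Hhd1 : h < d1) by (eapply Rlt_le_trans; [exact Hh2 | apply Rmin_l]).
  assert (Hhd2 : h < d2) by (eapply Rlt_le_trans; [exact Hh2 | apply Rmin_r]).
  replace (t - s) with (h + (t - (s + h))) by ring.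
  rewrite (Rplus_comm s h) at 2.
  rewrite (C0_plus HC0 h s), (C0_plus HC0 h (t - (s + h))) by lra.
  assert (He1 := H1 h (t - (s + h)) (conj Hh1 Hhd1) ltac:(lra)).
  assert (He2 := H2 h s (conj Hh1 Hhd2) ltac:(lra)).
  destruct (semigroup_generator (t - (s + h)) x ltac:(lra) Hx) as [Hdx _].
  destruct (semigroup_generator s y Hs Hy) as [Hdy _].
  assert (Hxa : norm (S (t - (s + h)) x) <= a) by (apply HSM; lra).
  assert (Hyb : norm (S s y) <= b) by (apply HSM; lra).
  set (x' := S (t - (s + h)) x) in *; set (y' := S s y) in *.
  set (e1 := plus (minus (S h x') x') (scal h (app A x'))) in He1.
  set (e2 := plus (minus (S h y') y') (scal h (app A y'))) in He2.
  assert (E : ip x' (S h y') = ip (S h x') y' + ip x' e2 - ip e1 y').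
  { unfold e1, e2; ip_expand Hip.
    rewrite (self_adjoint_sym Hsa x' y' Hdx Hdy); ring. }
  assert (B1 := cauchy_schwarz Hip e1 y'); apply Rabs_le_between in B1.
  assert (B2 := cauchy_schwarz Hip x' e2); apply Rabs_le_between in B2.
  assert (B1' : norm e1 * norm y' <= eps * h * b)
    by (apply Rmult_le_compat; auto using norm_ge_0).
  assert (B2' : norm x' * norm e2 <= a * (eps * h))
    by (apply Rmult_le_compat; auto using norm_ge_0).
  assert (B3 : eps * h * b + a * (eps * h) <= eta * h) by (rewrite <- Hea; nra).
  lra.
Qed.

Lemma semigroup_contraction t x : 0 <= t -> norm (S t x) <= norm x.
Proof.
  intros Ht; apply Rnot_lt_le; intros Hlt.
  assert (HSt := C0_linear HC0 t Ht).
  destruct (linear_norm _ HSt) as [K [HK HSK]].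
  destruct (proj1 Hsa x ((norm (S t x) - norm x) / (2 * (K + 1)))) as [y [Hy Hxy]].
  { apply Rdiv_lt_0_compat; lra. }
  assert (H1 := semigroup_contraction_dom t y Ht Hy).
  assert (H2 : norm (S t y) <= norm y).
  { apply Rsqr_incr_0; [unfold Rsqr; lra | apply norm_ge_0 | apply norm_ge_0]. }
  assert (H3 := HSK (minus x y)); rewrite (linear_minus _ _ _ HSt) in H3.
  assert (H4 := norm_triangle_inv (S t x) (S t y)); apply Rabs_le_between in H4.
  assert (H5 := norm_triangle_inv x y); apply Rabs_le_between in H5.
  assert (H6 : (K + 1) * norm (minus x y) <
    (K + 1) * ((norm (S t x) - norm x) / (2 * (K + 1))))
    by (apply Rmult_lt_compat_l; lra).
  replace ((K + 1) * ((norm (S t x) - norm x) / (2 * (K + 1)))) with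
    ((norm (S t x) - norm x) / 2) in H6 by (field; lra).
  lra.
Qed.

Lemma semigroup_sym t x y : 0 <= t -> ip (S t x) y = ip x (S t y).
Proof.
  intros Ht.
  assert (HSt := C0_linear HC0 t Ht).
  assert (Hdom : forall x y, dom A x -> dom A y -> ip (S t x) y = ip x (S t y)).
  { intros x' y' Hx Hy; apply Rle_antisym; [ | now apply semigroup_sym_le].
    rewrite (ip_sym Hip x'), (ip_sym Hip (S t x')); now apply semigroup_sym_le. }
  assert (Happrox : forall x y c, dom A y -> 0 < c ->
    Rabs (ip (S t x) y - ip x (S t y)) <= 2 * c * norm y).
  { intros x' y' c Hy Hcc.
    destruct (proj1 Hsa x' c Hcc) as [x'' [Hx'' Hd]].
    replace (ip (S t x') y' - ip x' (S t y')) with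
      (ip (S t (minus x' x'')) y' - ip (minus x' x'') (S t y')).
    - assert (B1 := cauchy_schwarz Hip (S t (minus x' x'')) y').
      assert (B2 := cauchy_schwarz Hip (minus x' x'') (S t y')).
      assert (B3 := semigroup_contraction t (minus x' x'') Ht).
      assert (B4 := semigroup_contraction t y' Ht).
      assert (N1 := norm_ge_0 y'); assert (N2 := norm_ge_0 (minus x' x'')).
      apply Rabs_le_between in B1; apply Rabs_le_between in B2.
      apply Rabs_le; nra.
    - rewrite (linear_minus _ _ _ HSt), !(ip_minus_l Hip), (Hdom x'' y') by assumption.
      ring. }
  assert (Hxd : forall x y, dom A y -> ip (S t x) y = ip x (S t y)).
  { intros x' y' Hy; apply Rminus_diag_uniq, Rabs_eq_0.
    apply Rle_antisym; [ | apply Rabs_pos].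
    apply le_epsilon; intros eps He.
    assert (N1 := norm_ge_0 y').
    assert (H := Happrox x' y' (eps / (2 * (norm y' + 1))) Hy
      ltac:(apply Rdiv_lt_0_compat; lra)).
    eapply Rle_trans; [exact H | ].
    apply Rmult_le_reg_r with (norm y' + 1); [lra | ].
    replace (2 * (eps / (2 * (norm y' + 1))) * norm y' * (norm y' + 1))
      with (eps * norm y') by (field; lra).
    nra. }
  apply Rminus_diag_uniq, Rabs_eq_0, Rle_antisym; [ | apply Rabs_pos].
  apply le_epsilon; intros eps He.
  assert (N1 := norm_ge_0 x).
  destruct (proj1 Hsa y (eps / (2 * (norm x + 1)))) as [y' [Hy' Hd]];
    [apply Rdiv_lt_0_compat; lra | ].
  replace (ip (S t x) y - ip x (S t y)) with
    (ip (S t x) (minus y y') - ip x (S t (minus y y'))).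
  2: { rewrite (linear_minus _ _ _ HSt), !(ip_minus_r Hip), (Hxd x y') by assumption.
       ring. }
  assert (B1 := cauchy_schwarz Hip (S t x) (minus y y')).
  assert (B2 := cauchy_schwarz Hip x (S t (minus y y'))).
  assert (B3 := semigroup_contraction t (minus y y') Ht).
  assert (B4 := semigroup_contraction t x Ht).
  assert (N2 := norm_ge_0 (minus y y')).
  apply Rabs_le_between in B1; apply Rabs_le_between in B2.
  assert (B5 : 2 * (norm x * norm (minus y y')) <= eps).
  { apply Rle_trans with (2 * ((norm x + 1) * (eps / (2 * (norm x + 1))))).
    - nra.
    - right; field; lra. }
  apply Rabs_le; nra.
Qed.

End Generated.

(** * Lower bound for A^(-beta) *)

Lemma is_RInt_gen_approx {X : NormedModule R_AbsRing} (F : R -> X) (l : X)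
    (eps a0 b0 : R) :
  is_RInt_gen F (at_right 0) (Rbar_locally p_infty) l -> 0 < eps -> 0 < a0 ->
  exists a b I, 0 < a < a0 /\ b0 < b /\ is_RInt F a b I /\ norm (minus I l) < eps.
Proof.
  intros H He Ha0.
  destruct (H (fun I => norm (minus I l) < eps)) as [Q R HQ HR HQR].
  { exact (locally_ball_norm l (mkposreal _ He)). }
  destruct HQ as [d Hd]; destruct HR as [M HM].
  set (a := Rmin d a0 / 2); set (b := Rmax M b0 + 1).
  assert (Hda := cond_pos d).
  assert (Ha : 0 < Rmin d a0) by (apply Rmin_pos; lra).
  assert (Ha1 := Rmin_l d a0); assert (Ha2 := Rmin_r d a0).
  assert (Hb1 := Rmax_l M b0); assert (Hb2 := Rmax_r M b0).
  destruct (HQR a b) as [I [HI1 HI2]].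
  - apply Hd; [ | unfold a; lra].
    change (Rabs (a - 0) < d); rewrite Rabs_pos_eq; unfold a; lra.
  - apply HM; unfold b; lra.
  - exists a, b, I; repeat split; try assumption; unfold a, b; lra.
Qed.

Lemma Rpower_pos x y : 0 < Rpower x y.
Proof. apply exp_pos. Qed.

Lemma Rpower_small b eps : 0 < b -> 0 < eps ->
  exists d, 0 < d /\ forall a, 0 < a < d -> Rpower a b < eps.
Proof.
  intros Hb He; exists (Rpower eps (/ b)); split; [apply Rpower_pos | ].
  intros a Ha.
  replace eps with (Rpower (Rpower eps (/ b)) b) at 1.
  - apply Rlt_Rpower_l; assumption.
  - rewrite Rpower_mult, Rinv_l, Rpower_1; lra.
Qed.

Lemma Rpower_decr a x y : a <= 0 -> 0 < x <= y -> Rpower y a <= Rpower x a.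
Proof.
  intros Ha Hxy; rewrite <- (Ropp_involutive a), !(Rpower_Ropp _ (- a)).
  apply Rinv_le_contravar; [apply Rpower_pos | apply Rle_Rpower_l; lra].
Qed.

Lemma is_derive_Rpower b t : 0 < t ->
  is_derive (fun t => Rpower t b) t (b * Rpower t (b - 1)).
Proof.
  intros Ht; apply is_derive_Reals, derivable_pt_lim_power, Ht.
Qed.

Lemma continuous_Rpower b t : 0 < t -> continuous (fun t => Rpower t b) t.
Proof.
  intros Ht.
  apply (ex_derive_continuous (K := R_AbsRing) (V := R_NormedModule)).
  eexists; now apply is_derive_Rpower.
Qed.

Lemma is_RInt_Rpower b a d : b <> 0 -> 0 < a <= d ->
  is_RInt (fun t => Rpower t (b - 1)) a d ((Rpower d b - Rpower a b) / b).
Proof.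
  intros Hb Had.
  replace ((Rpower d b - Rpower a b) / b) with
    (minus (Rpower d b / b) (Rpower a b / b))
    by (unfold minus, plus, opp; simpl; field; exact Hb).
  apply (is_RInt_derive (fun t => Rpower t b / b)).
  - intros x Hx; rewrite Rmin_left, Rmax_right in Hx by lra.
    replace (Rpower x (b - 1)) with (/ b * (b * Rpower x (b - 1)))
      by (field; exact Hb).
    apply (is_derive_ext (fun t => / b * Rpower t b)); [intros; apply Rmult_comm | ].
    apply is_derive_scal, is_derive_Rpower; lra.
  - intros x Hx; rewrite Rmin_left, Rmax_right in Hx by lra.
    apply continuous_Rpower; lra.
Qed.

Section SymmetricContraction.
Context {X : NormedModule R_AbsRing} {ip : X -> X -> R}
  (Hip : is_inner_product ip) {S : R -> X -> X} (HS : C0_semigroup S)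
  (Hcon : forall t x, 0 <= t -> norm (S t x) <= norm x)
  (Hsym : forall t x y, 0 <= t -> ip (S t x) y = ip x (S t y)).

Lemma is_linear_ip z : is_linear (fun x : X => ip x z : R).
Proof.
  constructor.
  - intros x y; apply (ip_plus_l Hip).
  - intros k x; apply (ip_scal_l Hip).
  - exists (norm z + 1); split; [assert (H := norm_ge_0 z); lra | intros x].
    change (Rabs (ip x z) <= (norm z + 1) * norm x).
    eapply Rle_trans; [apply (cauchy_schwarz Hip) | ].
    assert (H := norm_ge_0 x); lra.
Qed.

Lemma orbit_continuous y t : 0 < t -> continuous (fun s => S s y) t.
Proof.
  intros Ht; apply filterlim_locally_ball_norm; intros eps.
  destruct (C0_cont0 HS y eps (cond_pos eps)) as [d [Hd H]].
  exists (mkposreal (Rmin d t) (Rmin_pos _ _ Hd Ht)); intros s Hs.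
  change (Rabs (s - t) < Rmin d t) in Hs; unfold ball_norm.
  assert (H1 := Rmin_l d t); assert (H2 := Rmin_r d t).
  apply Rabs_lt_between in Hs.
  destruct (Rle_or_lt t s) as [Hts | Hts].
  - replace s with (t + (s - t)) by ring.
    rewrite (C0_plus HS), <- (linear_minus _ _ _ (C0_linear HS t ltac:(lra))) by lra.
    eapply Rle_lt_trans; [apply Hcon; lra | apply H; lra].
  - replace t with (s + (t - s)) by ring.
    rewrite (C0_plus HS), norm_minus_sym,
      <- (linear_minus _ _ _ (C0_linear HS s ltac:(lra))) by lra.
    eapply Rle_lt_trans; [apply Hcon; lra | apply H; lra].
Qed.

Lemma form_continuous y z t : 0 < t -> continuous (fun s => ip (S s y) z) t.
Proof.
  intros Ht; apply (continuous_comp (fun s => S s y) (fun x => ip x z)).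
  - now apply orbit_continuous.
  - exact (linear_cont _ _ (is_linear_ip z)).
Qed.

(** Halving the time turns the form into a square. This replaces functional calculus in proving that
    [<S(t) y, y>] is nonnegative and nonincreasing. *)
Lemma form_square y t : 0 <= t -> ip (S (t + t) y) y = norm (S t y) ^ 2.
Proof.
  intros Ht; rewrite (C0_plus HS), Hsym, (ip_norm Hip) by lra; reflexivity.
Qed.

Lemma form_ge0 y t : 0 <= t -> 0 <= ip (S t y) y.
Proof.
  intros Ht; replace t with (t / 2 + t / 2) by field.
  rewrite form_square by lra; apply pow2_ge_0.
Qed.

Lemma form_decr y s t : 0 <= s <= t -> ip (S t y) y <= ip (S s y) y.
Proof.
  intros Hst; replace t with (t / 2 + t / 2) by field.
  replace s with (s / 2 + s / 2) by field.
  rewrite !form_square by lra; apply pow_incr; split; [apply norm_ge_0 | ].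
  replace (t / 2) with ((t - s) / 2 + s / 2) by field.
  rewrite (C0_plus HS) by lra; apply Hcon; lra.
Qed.

(** After translation only the integrals of [psi] over [[a, a + h]] and [[d, d + h]] survive, and
    monotonicity bounds each by an endpoint value. *)
Lemma decreasing_shift_integral (psi : R -> R) a d h :
  0 < a -> 0 < h -> a <= d ->
  (forall t, 0 < t -> continuous psi t) ->
  (forall s t, 0 < s <= t -> psi t <= psi s) ->
  exists I, is_RInt (fun t => psi t - psi (t + h)) a d I /\
    h * (psi (a + h) - psi d) <= I.
Proof.
  intros Ha Hh Had Hc Hdec.
  assert (Hex : forall s t, 0 < s <= t -> ex_RInt psi s t).
  { intros s t Hst; apply (ex_RInt_continuous (V := R_CompleteNormedModule)).
    intros x Hx; rewrite Rmin_left in Hx by lra; apply Hc; lra. }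
  destruct (Hex a (a + h)) as [I1 HI1]; [lra | ].
  destruct (Hex d (d + h)) as [I2 HI2]; [lra | ].
  destruct (Hex a d) as [I3 HI3]; [lra | ].
  exists (I1 - I2); split.
  - assert (H1 : is_RInt psi (a + h) (d + h) (I3 + I2 - I1)).
    { assert (H := is_RInt_Chasles _ _ _ _ _ _ HI3 HI2).
      assert (H' := is_RInt_Chasles _ _ _ _ _ _ (is_RInt_swap _ _ _ _ HI1) H).
      replace (I3 + I2 - I1) with (plus (opp I1) (plus I3 I2))
        by (unfold plus, opp; simpl; ring).
      exact H'. }
    replace (a + h) with (1 * a + h) in H1 by ring.
    replace (d + h) with (1 * d + h) in H1 by ring.
    apply is_RInt_comp_lin in H1.
    replace (I1 - I2) with (minus I3 (I3 + I2 - I1))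
      by (unfold minus, plus, opp; simpl; ring).
    apply (is_RInt_ext (fun t => minus (psi t) (scal 1 (psi (1 * t + h))))).
    + intros t _; unfold minus, plus, opp, scal; simpl; unfold mult; simpl.
      replace (1 * t + h) with (t + h) by ring; ring.
    + exact (is_RInt_minus _ _ _ _ _ _ HI3 H1).
  - assert (H1 : h * psi (a + h) <= I1).
    { apply (is_RInt_le (fun _ => psi (a + h)) psi a (a + h)); [lra | | exact HI1 | ].
      - replace (h * psi (a + h)) with (scal (a + h - a) (psi (a + h)))
          by (unfold scal; simpl; unfold mult; simpl; ring).
        apply (is_RInt_const (V := R_NormedModule)).
      - intros t Ht; apply Hdec; lra. }
    assert (H2 : I2 <= h * psi d).
    { apply (is_RInt_le psi (fun _ => psi d) d (d + h)); [lra | exact HI2 | | ].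
      - replace (h * psi d) with (scal (d + h - d) (psi d))
          by (unfold scal; simpl; unfold mult; simpl; ring).
        apply (is_RInt_const (V := R_NormedModule)).
      - intros t Ht; apply Hdec; lra. }
    lra.
Qed.

(* With [w = h^-1 (x - S(h) x) + (b / d) x], a discretization of
   [A x + (b / d) x], the pairing is the integral over [t] of
   [t^(b-1) ((psi(t) - psi(t+h)) / h + (b / d) psi(t))], where
   [psi(t) = <S(t + 4h) y, y>] is nonnegative and decreasing.  On [(0, d)] one
   bounds [t^(b-1)] below by [d^(b-1)] in the first term and [psi(t)] by
   [psi(d)] in the second one; the two occurrences of [psi(d)] cancel. *)
Lemma pow_graph_pairing b G x y h d :
  0 < b < 1 -> 0 < h -> 0 < d ->
  is_RInt_gen (fun t => scal (Rpower t (b - 1)) (S t y))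
    (at_right 0) (Rbar_locally p_infty) (scal G x) ->
  Rpower d (b - 1) * norm (S (3 * h) y) ^ 2 <=
  G * ip (S h (plus (scal (/ h) (minus x (S h x))) (scal (b / d) x)))
         (S (3 * h) y).
Proof.
  intros Hb Hh Hd HG.
  set (z := plus (scal (/ h) (minus y (S h y))) (scal (b / d) y)).
  set (Z := S (4 * h) z).
  assert (HSh := C0_linear HS h ltac:(lra)).
  assert (HS4 := C0_linear HS (4 * h) ltac:(lra)).
  assert (EZ : ip (S h (plus (scal (/ h) (minus x (S h x))) (scal (b / d) x)))
                 (S (3 * h) y) = ip x Z).
  { rewrite Hsym by lra; rewrite <- (C0_plus HS) by lra.
    replace (h + 3 * h) with (4 * h) by ring.
    unfold Z, z; rewrite (linear_plus _ HS4), !(linear_scal _ HS4),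
      (linear_minus _ _ _ HS4).
    ip_expand Hip; rewrite (Hsym h x), (C0_comm HS h (4 * h)) by lra; reflexivity. }
  rewrite EZ.
  set (psi := fun t => ip (S t y) (S (4 * h) y)).
  assert (Epsi : forall t, 0 <= t -> psi t = ip (S (t + 4 * h) y) y).
  { intros t Ht; unfold psi; rewrite <- Hsym by lra.
    rewrite <- (C0_plus HS) by lra; now rewrite Rplus_comm. }
  assert (Hpsi0 : forall t, 0 <= t -> 0 <= psi t).
  { intros t Ht; rewrite Epsi by exact Ht; apply form_ge0; lra. }
  assert (Hpsid : forall s t, 0 <= s <= t -> psi t <= psi s).
  { intros s t Hst; rewrite !Epsi by lra; apply form_decr; lra. }
  assert (Hpsic : forall t, 0 < t -> continuous psi t)
    by (intros t Ht; now apply form_continuous).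
  assert (EtZ : forall t, 0 <= t ->
    ip (S t y) Z = / h * (psi t - psi (t + h)) + b / d * psi t).
  { intros t Ht; unfold Z, z; rewrite (linear_plus _ HS4), !(linear_scal _ HS4),
      (linear_minus _ _ _ HS4).
    ip_expand Hip; unfold psi.
    rewrite (C0_comm HS (4 * h) h), <- (Hsym h (S t y)) by lra.
    rewrite <- (C0_plus HS h t), (Rplus_comm h t) by lra; ring. }
  (* This fixes the factor 3: pairing with [S(k h) y] gives [psi(2h) = <S((k+3)h) y, y>], which is
     [|S(k h) y|^2] exactly when [k = 3]. The argument [2 * h] bounds [a + h] from above, as the
     cutoff satisfies [a < h]. *)
  assert (EN : psi (2 * h) = norm (S (3 * h) y) ^ 2).
  { rewrite Epsi by lra; replace (2 * h + 4 * h) with (3 * h + 3 * h) by ring.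
    apply form_square; lra. }
  rewrite <- EN.
  apply le_epsilon; intros eps Heps.
  assert (HZ := norm_ge_0 Z); assert (Hpd := Hpsi0 d ltac:(lra)).
  destruct (Rpower_small b (eps * d / (2 * (psi d + 1)))) as [a1 [Ha1 Hsmall]];
    [lra | apply Rdiv_lt_0_compat; nra | ].
  destruct (is_RInt_gen_approx _ _ (eps / (2 * (norm Z + 1)))
    (Rmin a1 (Rmin h d)) d HG) as [a [c [I [Ha [Hc [HI HIn]]]]]].
  { apply Rdiv_lt_0_compat; lra. }
  { repeat apply Rmin_pos; lra. }
  assert (Haa1 : a < a1) by (eapply Rlt_le_trans; [apply Ha | apply Rmin_l]).
  assert (Hah : a < h).
  { eapply Rlt_le_trans; [apply Ha | eapply Rle_trans; [apply Rmin_r | apply Rmin_l]]. }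
  assert (Had : a < d).
  { eapply Rlt_le_trans; [apply Ha | eapply Rle_trans; [apply Rmin_r | apply Rmin_r]]. }
  set (g := fun t => Rpower t (b - 1) *
    (/ h * (psi t - psi (t + h)) + b / d * psi t)).
  assert (Hg : is_RInt g a c (ip I Z)).
  { apply (is_RInt_linear (fun w => ip w Z : R) _ _ _ _ (is_linear_ip Z)) in HI.
    eapply is_RInt_ext; [ | exact HI].
    intros t Ht; rewrite Rmin_left in Ht by lra; cbv beta; unfold g.
    rewrite (ip_scal_l Hip), EtZ by lra; reflexivity. }
  destruct (decreasing_shift_integral psi a d h) as [I1 [HI1 HI1']];
    [lra | lra | lra | exact Hpsic | intros; apply Hpsid; lra | ].
  assert (HI2 := is_RInt_Rpower b a d ltac:(lra) ltac:(lra)).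
  set (I2 := (Rpower d b - Rpower a b) / b) in HI2.
  assert (Hex1 : ex_RInt g a d).
  { apply (ex_RInt_continuous (V := R_CompleteNormedModule)).
    intros t Ht; rewrite Rmin_left in Ht by lra; unfold g.
    apply (continuous_mult (fun t => Rpower t (b - 1)));
      [apply continuous_Rpower; lra | ].
    apply (continuous_plus (fun t => / h * (psi t - psi (t + h)))).
    - apply (continuous_scal_r (/ h) (fun t => psi t - psi (t + h))).
      apply (continuous_minus psi (fun t => psi (t + h))); [apply Hpsic; lra | ].
      apply (continuous_comp (fun t => t + h) psi); [ | apply Hpsic; lra].
      apply (continuous_plus (fun t => t) (fun _ => h));
        [apply continuous_id | apply continuous_const].
    - apply (continuous_scal_r (b / d) psi), Hpsic; lra. }
  destruct Hex1 as [J1 HJ1].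
  assert (HJ2 := is_RInt_Chasles _ _ _ _ _ _ (is_RInt_swap _ _ _ _ HJ1) Hg).
  assert (Hg0 : forall t, 0 < t -> 0 <= g t).
  { intros t Ht; unfold g.
    assert (Hi : 0 < / h) by now apply Rinv_0_lt_compat.
    assert (Hbd : 0 < b / d) by (apply Rdiv_lt_0_compat; lra).
    assert (H1 := Hpsid t (t + h) ltac:(lra)); assert (H2 := Hpsi0 t ltac:(lra)).
    apply Rmult_le_pos; [left; apply Rpower_pos | ].
    apply Rplus_le_le_0_compat; apply Rmult_le_pos; lra. }
  assert (HJ2' : 0 <= plus (opp J1) (ip I Z)).
  { apply (is_RInt_le (fun _ => 0) g d c); [lra | | exact HJ2 | ].
    - assert (H0 := is_RInt_const (V := R_NormedModule) d c 0).
      change (is_RInt (fun _ => 0) d c ((c - d) * 0)) in H0.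
      rewrite Rmult_0_r in H0; exact H0.
    - intros t Ht; apply Hg0; lra. }
  assert (HJ1' : Rpower d (b - 1) * / h * I1 + b / d * psi d * I2 <= J1).
  { apply (is_RInt_le (fun t => Rpower d (b - 1) * / h * (psi t - psi (t + h)) +
      b / d * psi d * Rpower t (b - 1)) g a d); [lra | | exact HJ1 | ].
    - apply (is_RInt_plus (V := R_NormedModule)
        (fun t => Rpower d (b - 1) * / h * (psi t - psi (t + h)))).
      + exact (is_RInt_scal _ _ _ (Rpower d (b - 1) * / h) _ HI1).
      + exact (is_RInt_scal _ _ _ (b / d * psi d) _ HI2).
    - intros t Ht; unfold g.
      assert (Hi : 0 < / h) by now apply Rinv_0_lt_compat.
      assert (Hbd : 0 < b / d) by (apply Rdiv_lt_0_compat; lra).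
      assert (H1 := Hpsid t (t + h) ltac:(lra)).
      assert (H2 := Hpsid t d ltac:(lra)).
      assert (H3 := Rpower_decr (b - 1) t d ltac:(lra) ltac:(lra)).
      assert (H4 := Rpower_pos t (b - 1)).
      rewrite Rmult_plus_distr_l; apply Rplus_le_compat.
      + rewrite Rmult_assoc; apply Rmult_le_compat_r; [ | exact H3].
        apply Rmult_le_pos; lra.
      + rewrite Rmult_comm; apply Rmult_le_compat_l; [lra | ].
        apply Rmult_le_compat_l; lra. }
  assert (HI2' : b / d * psi d * I2 =
    Rpower d (b - 1) * psi d - psi d * Rpower a b / d).
  { replace (Rpower d (b - 1)) with (Rpower d b / d).
    - unfold I2; field; lra.
    - unfold Rminus; rewrite Rpower_plus, Rpower_Ropp, Rpower_1 by lra; reflexivity. }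
  assert (HI1'' : Rpower d (b - 1) * (psi (2 * h) - psi d) <=
    Rpower d (b - 1) * / h * I1).
  { rewrite Rmult_assoc; apply Rmult_le_compat_l; [left; apply Rpower_pos | ].
    apply Rmult_le_reg_l with h; [exact Hh | ].
    rewrite <- Rmult_assoc, Rinv_r, Rmult_1_l by lra.
    assert (H := Hpsid (a + h) (2 * h) ltac:(lra)).
    eapply Rle_trans; [ | exact HI1']; apply Rmult_le_compat_l; lra. }
  assert (Herr1 : psi d * Rpower a b / d <= eps / 2).
  { assert (H := Hsmall a (conj (proj1 Ha) Haa1)).
    apply Rmult_le_reg_r with d; [exact Hd | ].
    replace (psi d * Rpower a b / d * d) with (psi d * Rpower a b) by (field; lra).
    apply Rle_trans with ((psi d + 1) * (eps * d / (2 * (psi d + 1)))).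
    - assert (H' := Rpower_pos a b).
      apply Rmult_le_compat; lra.
    - right; field; lra. }
  assert (Herr2 : ip I Z <= G * ip x Z + eps / 2).
  { assert (H := ip_le_norm Hip (minus I (scal G x)) Z).
    rewrite (ip_minus_l Hip), (ip_scal_l Hip) in H.
    assert (H' : norm (minus I (scal G x)) * norm Z <= eps / 2).
    { apply Rle_trans with (eps / (2 * (norm Z + 1)) * (norm Z + 1)).
      - apply Rmult_le_compat; [apply norm_ge_0 | lra | lra | lra].
      - right; field; lra. }
    lra. }
  unfold plus, opp in HJ2'; simpl in HJ2'; lra.
Qed.

(** Cauchy-Schwarz in the pairing, then division by one factor [|S(3h) y|]. The free parameter [d]
    is later tuned so that [b / d] becomes the shift [2 / T]. *)
Lemma pow_graph_bound b G x y h d :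
  0 < b < 1 -> 0 < h -> 0 < d -> 0 <= G ->
  is_RInt_gen (fun t => scal (Rpower t (b - 1)) (S t y))
    (at_right 0) (Rbar_locally p_infty) (scal G x) ->
  norm (S (3 * h) y) <= G * Rpower d (1 - b) *
    norm (S h (plus (scal (/ h) (minus x (S h x))) (scal (b / d) x))).
Proof.
  intros Hb Hh Hd HG Hxy.
  assert (H := pow_graph_pairing b G x y h d Hb Hh Hd Hxy).
  set (w := S h _) in *; set (v := S (3 * h) y) in *.
  assert (H1 := ip_le_norm Hip w v).
  assert (Hw := norm_ge_0 w); assert (Hv := norm_ge_0 v).
  assert (Hp := Rpower_pos d (1 - b)).
  replace (b - 1) with (- (1 - b)) in H by ring; rewrite Rpower_Ropp in H.
  destruct Hv as [Hv | Hv].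
  - apply Rmult_le_reg_l with (norm v / Rpower d (1 - b));
      [now apply Rdiv_lt_0_compat | ].
    replace (norm v / Rpower d (1 - b) * (G * Rpower d (1 - b) * norm w)) with
      (G * (norm w * norm v)) by (field; lra).
    replace (norm v / Rpower d (1 - b) * norm v) with
      (/ Rpower d (1 - b) * norm v ^ 2) by (field; lra).
    eapply Rle_trans; [exact H | apply Rmult_le_compat_l; lra].
  - rewrite <- Hv; apply Rmult_le_pos; [apply Rmult_le_pos; lra | exact Hw].
Qed.

End SymmetricContraction.

(** * The discrete energy method *)

Fixpoint psum (f : nat -> R) (n : nat) : R :=
  match n with O => 0 | S k => psum f k + f k end.

Lemma psum_S f n : psum f (S n) = psum f n + f n.
Proof. reflexivity. Qed.

Lemma psum_ext f g n : (forall k, f k = g k) -> psum f n = psum g n.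
Proof. intros H; induction n; simpl; [reflexivity | now rewrite IHn, H]. Qed.

Lemma psum_le f g n :
  (forall k, (k < n)%nat -> f k <= g k) -> psum f n <= psum g n.
Proof.
  induction n; simpl; intros H; [lra | ].
  apply Rplus_le_compat; [apply IHn; intros; apply H; lia | apply H; lia].
Qed.

Lemma psum_plus f g n : psum (fun k => f k + g k) n = psum f n + psum g n.
Proof. induction n; simpl; [ring | rewrite IHn; ring]. Qed.

Lemma psum_scal c f n : psum (fun k => c * f k) n = c * psum f n.
Proof. induction n; simpl; [ring | rewrite IHn; ring]. Qed.

Lemma psum_const c n : psum (fun _ => c) n = INR n * c.
Proof. induction n; [simpl; ring | rewrite S_INR; simpl; rewrite IHn; ring]. Qed.

Lemma psum_telescope f n : psum (fun k => f (S k) - f k) n = f n - f O.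
Proof. induction n; simpl; [ring | rewrite IHn; ring]. Qed.

Lemma psum_shift f N i :
  (forall k, f (k + N)%nat = f k) -> psum (fun k => f (k + i)%nat) N = psum f N.
Proof.
  intros Hf; induction i as [ | i IH].
  - apply psum_ext; intros k; now rewrite Nat.add_0_r.
  - rewrite <- IH.
    assert (H := psum_telescope (fun k => f (k + i)%nat) N).
    cbv beta in H; rewrite (Nat.add_comm N i), (Hf i), Rminus_diag in H.
    rewrite (psum_ext (fun k => f (S k + i)%nat - f (k + i)%nat)
      (fun k => f (k + S i)%nat + (-1) * f (k + i)%nat)) in H.
    + rewrite psum_plus, psum_scal in H; lra.
    + intros k; rewrite Nat.add_succ_r; simpl; ring.
Qed.

Lemma psum_odd_squares c n :
  psum (fun j => (2 * INR j + 1 - c) ^ 2) n =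
  INR n * (4 * INR n ^ 2 - 1) / 3 - 2 * c * INR n ^ 2 + c ^ 2 * INR n.
Proof.
  induction n as [ | n IH]; [simpl; field | ].
  rewrite psum_S, IH, S_INR; field.
Qed.

Section Discrete.
Context {X : NormedModule R_AbsRing} {ip : X -> X -> R}
  (Hip : is_inner_product ip).

(** The discrete form of [sup |p|^2 <= (T / 12) int |p'|^2]. The sawtooth [w] has slope [1 / N] and
    total increase one over a period, so summation by parts against it recovers [|p 0|^2], the mean
    being zero. *)
Lemma discrete_wirtinger (p : nat -> X) N : (0 < N)%nat ->
  (forall j, p (j + N)%nat = p j) ->
  (forall z, psum (fun j => ip (p j) z) N = 0) ->
  norm (p O) ^ 2 <= INR N / 12 * psum (fun j => norm (minus (p (S j)) (p j)) ^ 2) N.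
Proof.
  intros HN Hper Hmean.
  assert (HNR : 0 < INR N) by now apply lt_0_INR.
  set (w := fun j => (2 * INR j + 1 - INR N) / (2 * INR N)).
  set (P := norm (p O)); set (D := fun j => norm (minus (p (S j)) (p j))).
  set (a := fun j => ip (p j) (p O)).
  assert (HP : 0 <= P) by apply norm_ge_0.
  assert (HD : forall j, 0 <= D j) by (intro; apply norm_ge_0).
  assert (Habel : forall n, psum (fun j => w j * (a (S j) - a j)) n =
    w n * a n - w O * a O - / INR N * psum (fun j => a (S j)) n).
  { induction n as [ | n IH]; [simpl; ring | ].
    rewrite !psum_S, IH.
    assert (E : w (S n) = w n + / INR N)
      by (unfold w; rewrite S_INR; field; lra).
    rewrite E; ring. }
  assert (Ha0 : psum (fun j => a (S j)) N = 0).
  { rewrite <- (Hmean (p O)).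
    rewrite <- (psum_shift (fun j => ip (p j) (p O)) N 1)
      by (intros k; now rewrite Hper).
    apply psum_ext; intros k; unfold a; now rewrite Nat.add_1_r. }
  assert (E1 : P ^ 2 = psum (fun j => w j * (a (S j) - a j)) N).
  { rewrite Habel, Ha0; unfold a, P.
    assert (HN0 := Hper O); simpl in HN0; rewrite HN0, (ip_norm Hip).
    unfold w; simpl INR; field; lra. }
  assert (E2 : psum (fun j => w j ^ 2) N <= INR N / 12).
  { rewrite (psum_ext _ (fun j => / (4 * INR N ^ 2) * (2 * INR j + 1 - INR N) ^ 2))
      by (intros k; unfold w; field; lra).
    rewrite psum_scal, psum_odd_squares.
    replace (/ (4 * INR N ^ 2) * _) with (INR N / 12 - / (12 * INR N))
      by (field; lra).
    assert (0 < / (12 * INR N)) by (apply Rinv_0_lt_compat; lra); lra. }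
  (* The weights are balanced so that, by [E2], the first terms sum to at most [P ^ 2 / 2], which
     the left side absorbs. *)
  assert (E3 : P ^ 2 <=
    psum (fun j => 6 / INR N * P ^ 2 * w j ^ 2 + INR N / 24 * D j ^ 2) N).
  { eapply Rle_trans; [right; exact E1 | apply psum_le; intros j _].
    assert (H1 := cauchy_schwarz Hip (minus (p (S j)) (p j)) (p O)).
    rewrite (ip_minus_l Hip) in H1; fold (a (S j)) in H1; fold (a j) in H1.
    fold (D j) in H1; fold P in H1.
    eapply Rle_trans; [apply Rle_abs | rewrite Rabs_mult].
    apply Rle_trans with (Rabs (w j) * (D j * P)).
    - apply Rmult_le_compat_l; [apply Rabs_pos | exact H1].
    - rewrite <- (pow2_abs (w j)); set (c := Rabs (w j)).
      (* AM-GM: the difference of the two sides is this square. *)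
      assert (H : 0 <= 6 / INR N * (c * P - INR N / 12 * D j) ^ 2).
      { apply Rmult_le_pos; [ | apply pow2_ge_0].
        apply Rlt_le, Rdiv_lt_0_compat; lra. }
      replace (6 / INR N * (c * P - INR N / 12 * D j) ^ 2) with
        (6 / INR N * P ^ 2 * c ^ 2 + INR N / 24 * D j ^ 2 - c * (D j * P)) in H
        by (field; lra).
      lra. }
  rewrite psum_plus, !psum_scal in E3; fold D.
  assert (E4 : 6 / INR N * P ^ 2 * psum (fun j => w j ^ 2) N <= P ^ 2 / 2).
  { replace (P ^ 2 / 2) with (6 / INR N * P ^ 2 * (INR N / 12)) by (field; lra).
    apply Rmult_le_compat_l; [ | exact E2].
    apply Rmult_le_pos; [ | apply pow2_ge_0].
    apply Rlt_le, Rdiv_lt_0_compat; lra. }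
  change (P ^ 2 <= INR N / 12 * psum (fun j => D j ^ 2) N); lra.
Qed.

Lemma norm_plus_square_le (s : R) (x y : X) : 0 < s ->
  norm (plus x y) ^ 2 <= (1 + s) * norm x ^ 2 + (1 + / s) * norm y ^ 2.
Proof.
  intros Hs; rewrite !(ip_norm Hip); ip_expand Hip.
  assert (H := ip_ge0 Hip (minus (scal s x) y)); revert H; ip_expand Hip.
  rewrite (ip_sym Hip y x); intros H.
  apply (Rmult_le_compat_l (/ s)) in H; [ | left; now apply Rinv_0_lt_compat].
  replace (/ s * (s * (s * ip x x) - s * ip x y - (s * ip x y - ip y y))) with
    (s * ip x x - 2 * ip x y + / s * ip y y) in H by (field; lra).
  lra.
Qed.

(** [s] stands for e^(-hA) and [v j] for the difference of solutions after [j] steps. [Hpos] is the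
    operator inequality [s^2 <= s], which contains both nonnegativity and contractivity. *)
Context {s : X -> X} (Hlin : is_linear s)
  (Hsym : forall x y, ip (s x) y = ip x (s y))
  (Hpos : forall x, norm (s x) ^ 2 <= ip x (s x))
  {v : nat -> X} {N : nat} (HN : (0 < N)%nat)
  (Hper : forall j, v (j + N)%nat = v j)
  (Hmean : forall z, psum (fun j => ip (v j) z) N = 0).

Let R2 := psum (fun j => norm (minus (v (S j)) (s (v j))) ^ 2) N.

Let D2 := psum (fun j => norm (s (minus (v (S j)) (v j))) ^ 2) N.

(** With [d = v (S j) - v j], the summand of [R2] minus that of the first sum is exactly
    [F (S j) - F j + <d, s d>], and the [F] terms cancel over a period. [F] is the discrete
    [h <A v, v>], whose derivative is the cross term. [Hpos] bounds [<d, s d>] below by [|s d|^2],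
    hence the [s] inside [D2]. *)
Lemma discrete_energy :
  psum (fun j => norm (minus (v j) (s (v j))) ^ 2) N + D2 <= R2.
Proof.
  set (F := fun j => norm (v j) ^ 2 - ip (v j) (s (v j))).
  assert (H := psum_telescope F N).
  replace (F N) with (F O) in H by (unfold F; assert (HN0 := Hper O); simpl in HN0; now rewrite HN0).
  apply Rle_trans with (psum (fun j => norm (minus (v (S j)) (s (v j))) ^ 2
    + (-1) * (F (S j) - F j)) N).
  - unfold D2; rewrite <- psum_plus; apply psum_le; intros j _.
    assert (H1 := Hpos (minus (v (S j)) (v j))); revert H1.
    unfold F; rewrite (linear_minus _ _ _ Hlin), !(ip_norm Hip); ip_expand Hip.
    rewrite !Hsym, (ip_sym Hip (v (S j)) (s (v j))), Hsym; lra.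
  - rewrite psum_plus, psum_scal, H; unfold R2; lra.
Qed.

(** [D2] sees only increments of [s (v j)], so Wirtinger is applied to this smoothed sequence,
    started at [j]; symmetry of [s] carries the zero mean over. *)
Lemma discrete_wirtinger_image j :
  norm (s (v j)) ^ 2 <= INR N / 12 * D2.
Proof.
  assert (H := discrete_wirtinger (fun i => s (v (i + j)%nat)) N HN).
  eapply Rle_trans; [apply H | ].
  - intros i; rewrite <- Nat.add_assoc, (Nat.add_comm N j), Nat.add_assoc.
    now rewrite Hper.
  - intros z; rewrite <- (Hmean (s z)).
    rewrite <- (psum_shift (fun i => ip (v i) (s z)) N j)
      by (intros i; now rewrite Hper).
    apply psum_ext; intros i; apply Hsym.
  - right; apply f_equal; unfold D2.
    rewrite <- (psum_shift (fun i => norm (s (minus (v (S i)) (v i))) ^ 2) N j).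
    + apply psum_ext; intros i; now rewrite (linear_minus _ _ _ Hlin).
    + intros i; change (S (i + N)) with (S i + N)%nat; now rewrite !Hper.
Qed.

(** [2 / INR N] is [h] times the shift [2 / T]. Young's inequality with parameter [1 / 3 = 2^2 / 12]
    gives the same coefficient [4 / 3] to the energy sum and, through Wirtinger, to [D2], so
    [discrete_energy] bounds the total. *)
Lemma discrete_elliptic :
  psum (fun j => norm (s (plus (minus (v j) (s (v j))) (scal (2 / INR N) (v j)))) ^ 2) N
  <= 4 / 3 * R2.
Proof.
  assert (HNR : 0 < INR N) by now apply lt_0_INR.
  assert (Hcon : forall x, norm (s x) ^ 2 <= norm x ^ 2).
  { intros x; assert (H1 := Hpos x); assert (H2 := ip_le_norm Hip x (s x)).
    assert (H3 := norm_ge_0 x); assert (H4 := norm_ge_0 (s x)); nra. }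
  assert (HE := discrete_energy).
  apply Rle_trans with (psum (fun j => 4 / 3 * norm (minus (v j) (s (v j))) ^ 2
    + 4 / (3 * INR N) * D2) N).
  - apply psum_le; intros j _.
    rewrite (linear_plus _ Hlin), (linear_scal _ Hlin).
    eapply Rle_trans; [apply (norm_plus_square_le (1 / 3)); lra | ].
    assert (H1 := Hcon (minus (v j) (s (v j)))).
    rewrite norm_scal_abs, Rabs_pos_eq by (left; apply Rdiv_lt_0_compat; lra).
    rewrite Rpow_mult_distr.
    assert (H2 := discrete_wirtinger_image j).
    apply (Rmult_le_compat_l ((1 + / (1 / 3)) * (2 / INR N) ^ 2)) in H2.
    2: { apply Rmult_le_pos; [lra | apply pow2_ge_0]. }
    replace ((1 + / (1 / 3)) * (2 / INR N) ^ 2 * (INR N / 12 * D2)) with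
      (4 / (3 * INR N) * D2) in H2 by (field; lra).
    lra.
  - rewrite psum_plus, psum_scal, psum_const.
    replace (INR N * (4 / (3 * INR N) * D2)) with (4 / 3 * D2) by (field; lra).
    lra.
Qed.

(** The loop closes here: the residuals are bounded by the smoothed [A^beta v], which
    [discrete_elliptic] bounds by the residuals again, with factor [q < 1]. Splitting off [eps] with
    Young parameter [sg] leaves the factor [(1 + q) / 2]; once this is absorbed, only the [eps] term
    remains. *)
Lemma discrete_rigidity (y : nat -> R) (h L C q eps : R) :
  0 < h -> 0 <= L -> 0 <= eps -> 0 <= q < 1 -> 4 / 3 * (C * L) ^ 2 <= q ->
  (forall j, (j < N)%nat -> 0 <= y j <= C / h *
    norm (s (plus (minus (v j) (s (v j))) (scal (2 / INR N) (v j))))) ->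
  (forall j, (j < N)%nat -> norm (minus (v (S j)) (s (v j))) <= h * L * (y j + eps)) ->
  norm (s (v O)) ^ 2 <=
    / 6 * / (1 - q) * (1 + 2 / (1 - q)) * (L * (INR N * h)) ^ 2 * eps ^ 2.
Proof.
  intros Hh HL He Hq HCL Hy Hr.
  assert (HNR : 0 < INR N) by now apply lt_0_INR.
  set (sg := (1 - q) / 2).
  assert (Hsg : 0 < sg) by (unfold sg; lra).
  assert (Hell := discrete_elliptic).
  set (W := psum _ N) in Hell.
  assert (HR0 : 0 <= R2).
  { replace 0 with (psum (fun _ => 0) N) by (rewrite psum_const; ring).
    apply psum_le; intros; apply pow2_ge_0. }
  assert (HR : R2 <= (1 + sg) * (C * L) ^ 2 * W
    + (1 + / sg) * (h * L * eps) ^ 2 * INR N).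
  { rewrite (Rmult_comm _ (INR N)), <- psum_const.
    unfold W; rewrite <- psum_scal, <- psum_plus.
    apply psum_le; intros j Hj.
    assert (H1 := Hy j Hj); assert (H2 := Hr j Hj).
    set (n := norm (s (plus (minus (v j) (s (v j))) (scal (2 / INR N) (v j))))) in *.
    set (r := norm (minus (v (S j)) (s (v j)))) in *.
    assert (Hr0 : 0 <= r) by apply norm_ge_0.
    assert (H3 : r <= C * L * n + h * L * eps).
    { eapply Rle_trans; [exact H2 | ].
      replace (C * L * n) with (h * L * (C / h * n)) by (field; lra).
      assert (H4 : h * L * y j <= h * L * (C / h * n)).
      { apply Rmult_le_compat_l; [apply Rmult_le_pos; lra | apply H1]. }
      lra. }
    assert (H4 : r ^ 2 <= (C * L * n + h * L * eps) ^ 2) by (apply pow_incr; lra).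
    eapply Rle_trans; [exact H4 | ].
    assert (H5 : 0 <= / sg * (sg * (C * L * n) - h * L * eps) ^ 2).
    { apply Rmult_le_pos; [left; now apply Rinv_0_lt_compat | apply pow2_ge_0]. }
    replace (/ sg * (sg * (C * L * n) - h * L * eps) ^ 2) with
      (sg * (C * L * n) ^ 2 - 2 * (C * L * n) * (h * L * eps)
       + / sg * (h * L * eps) ^ 2) in H5 by (field; lra).
    rewrite !Rpow_mult_distr in *; lra. }
  assert (HW : (1 + sg) * (C * L) ^ 2 * W <= (1 + q) / 2 * R2).
  { apply Rle_trans with ((1 + sg) * (C * L) ^ 2 * (4 / 3 * R2)).
    - apply Rmult_le_compat_l; [ | exact Hell].
      apply Rmult_le_pos; [lra | apply pow2_ge_0].
    - replace ((1 + sg) * (C * L) ^ 2 * (4 / 3 * R2)) with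
        ((1 + sg) * (4 / 3 * (C * L) ^ 2) * R2) by ring.
      apply Rmult_le_compat_r; [exact HR0 | ].
      apply Rle_trans with ((1 + sg) * q).
      + apply Rmult_le_compat_l; lra.
      + unfold sg; nra. }
  assert (Hfin : R2 <= 2 * / (1 - q) * ((1 + / sg) * (h * L * eps) ^ 2 * INR N)).
  { apply Rmult_le_reg_l with ((1 - q) / 2); [lra | ].
    replace ((1 - q) / 2 * (2 * / (1 - q) * ((1 + / sg) * (h * L * eps) ^ 2 * INR N)))
      with ((1 + / sg) * (h * L * eps) ^ 2 * INR N) by (field; lra).
    lra. }
  assert (HE := discrete_energy).
  assert (HE0 : 0 <= psum (fun j => norm (minus (v j) (s (v j))) ^ 2) N).
  { replace 0 with (psum (fun _ => 0) N) by (rewrite psum_const; ring).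
    apply psum_le; intros; apply pow2_ge_0. }
  eapply Rle_trans; [apply discrete_wirtinger_image | ].
  apply Rle_trans with (INR N / 12 * (2 * / (1 - q) *
    ((1 + / sg) * (h * L * eps) ^ 2 * INR N))).
  - apply Rmult_le_compat_l; lra.
  - right; unfold sg; field; lra.
Qed.

End Discrete.

(** * Improper integrals and the Gamma function *)

Lemma ex_RInt_pos (f : R -> R) a b :
  (forall t, 0 < t -> continuous f t) -> 0 < a -> 0 < b -> ex_RInt f a b.
Proof.
  intros Hc Ha Hb; apply (ex_RInt_continuous (V := R_CompleteNormedModule)).
  intros t Ht; apply Hc; eapply Rlt_le_trans; [ | apply Ht].
  now apply Rmin_pos.
Qed.

Lemma RInt_nonneg_le (f : R -> R) a a' b b' :
  (forall t, 0 < t -> continuous f t) -> (forall t, 0 < t -> 0 <= f t) ->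
  0 < a' <= a -> a <= b <= b' -> RInt f a b <= RInt f a' b'.
Proof.
  intros Hc H0 Ha Hb.
  assert (E1 := RInt_Chasles f a' a b' (ex_RInt_pos f a' a Hc ltac:(lra) ltac:(lra))
    (ex_RInt_pos f a b' Hc ltac:(lra) ltac:(lra))).
  assert (E2 := RInt_Chasles f a b b' (ex_RInt_pos f a b Hc ltac:(lra) ltac:(lra))
    (ex_RInt_pos f b b' Hc ltac:(lra) ltac:(lra))).
  assert (G1 := RInt_ge_0 f a' a ltac:(lra) (ex_RInt_pos f a' a Hc ltac:(lra) ltac:(lra))
    ltac:(intros; apply H0; lra)).
  assert (G2 := RInt_ge_0 f b b' ltac:(lra) (ex_RInt_pos f b b' Hc ltac:(lra) ltac:(lra))
    ltac:(intros; apply H0; lra)).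
  unfold plus in E1, E2; simpl in E1, E2; lra.
Qed.

(** For a nonnegative integrand the proper integrals grow with the interval, so their supremum is
    the limit. [Fb] and [D] cover both an upper limit at infinity and a fixed upper endpoint. *)
Lemma is_RInt_gen_nonneg (f : R -> R) (Fb : (R -> Prop) -> Prop) (D : R -> Prop)
    (B b1 : R) :
  (forall t, 0 < t -> continuous f t) -> (forall t, 0 < t -> 0 <= f t) ->
  (forall b, 0 < b -> D b -> Fb (fun c => b <= c /\ D c)) ->
  0 < b1 -> D b1 ->
  (forall a b, 0 < a <= b -> D b -> RInt f a b <= B) ->
  exists l, is_RInt_gen f (at_right 0) Fb l /\ l <= B /\
    forall a b, 0 < a <= b -> D b -> RInt f a b <= l.
Proof.
  intros Hc H0 HF Hb1 HD1 HB.
  set (E := fun r => exists a b, 0 < a <= b /\ D b /\ r = RInt f a b).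
  destruct (completeness E) as [l [Hl1 Hl2]].
  - exists B; intros r [a [b [Hab [Hb ->]]]]; now apply HB.
  - exists (RInt f b1 b1), b1, b1; repeat split; auto; lra.
  - exists l; split; [ | split].
    + intros P [eps HP].
      assert (Heps := cond_pos eps).
      assert (Hex : exists a b, 0 < a <= b /\ D b /\ l - eps < RInt f a b).
      { apply NNPP; intros Hn; apply (Rlt_not_le l (l - eps)); [lra | ].
        apply Hl2; intros r [a [b [Hab [Hb ->]]]].
        apply Rnot_lt_le; intros Hlt; apply Hn; now exists a, b. }
      destruct Hex as [a [b [Hab [Hb Hlt]]]].
      apply (Filter_prod _ _ _ (fun a' => 0 < a' < a) (fun c => b <= c /\ D c)).
      * exists (mkposreal a (proj1 Hab)); intros y Hy Hy0.
        change (Rabs (y - 0) < a) in Hy; rewrite Rabs_pos_eq in Hy; lra.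
      * apply HF; [lra | exact Hb].
      * intros a' b' Ha' [Hb' HDb']; exists (RInt f a' b'); split.
        { apply (RInt_correct (V := R_CompleteNormedModule)), ex_RInt_pos; auto;
            simpl; lra. }
        apply HP; change (Rabs (RInt f a' b' - l) < eps).
        assert (G1 := RInt_nonneg_le f a a' b b' Hc H0 ltac:(lra) ltac:(lra)).
        assert (G2 : RInt f a' b' <= l)
          by (apply Hl1; exists a', b'; repeat split; auto; lra).
        apply Rabs_lt_between; lra.
    + apply Hl2; intros r [a [b [Hab [Hb ->]]]]; now apply HB.
    + intros a b Hab Hb; apply Hl1; now exists a, b.
Qed.

Lemma continuous_exp_opp t : continuous (fun s => exp (- s)) t.
Proof.
  apply (continuous_comp (fun s => - s) exp).
  - apply (continuous_opp (V := R_NormedModule) (fun s => s)), continuous_id.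
  - apply continuous_exp.
Qed.

Lemma continuous_Rpower_exp b t :
  0 < t -> continuous (fun s => Rpower s b * exp (- s)) t.
Proof.
  intros Ht; apply (continuous_mult (fun s => Rpower s b)).
  - now apply continuous_Rpower.
  - apply continuous_exp_opp.
Qed.

Lemma Rpower_exp_pos b t : 0 < Rpower t b * exp (- t).
Proof. apply Rmult_lt_0_compat; apply exp_pos. Qed.

(** Weighted arithmetic-geometric mean inequality. With [t = e^x], add [b] times [H1] to [1 - b]
    times [H2]: the terms in [x] cancel. *)
Lemma Rpower_le_affine b t : 0 <= b <= 1 -> 0 < t -> Rpower t b <= 1 - b + b * t.
Proof.
  intros Hb Ht; unfold Rpower; rewrite <- (exp_ln t) at 2 by exact Ht.
  set (x := ln t).
  assert (H1 : exp (b * x) * (1 + (1 - b) * x) <= exp x).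
  { replace x with (b * x + (1 - b) * x) at 3 by ring.
    rewrite exp_plus; apply Rmult_le_compat_l; [left; apply exp_pos | ].
    apply exp_ineq1_le. }
  assert (H2 : exp (b * x) * (1 + - (b * x)) <= 1).
  { replace 1 with (exp (b * x) * exp (- (b * x))) at 2
      by (rewrite <- exp_plus, Rplus_opp_r; apply exp_0).
    apply Rmult_le_compat_l; [left; apply exp_pos | apply exp_ineq1_le]. }
  apply (Rmult_le_compat_l b) in H1; [ | lra].
  apply (Rmult_le_compat_l (1 - b)) in H2; lra.
Qed.

(** The upper bound amounts to Gamma(1 + b) <= 1: by [Rpower_le_affine], [t^b] is at most
    [1 - b + b t], whose integral against [e^(-t)] is 1. *)
Lemma Gamma_pos_le b : 0 < b < 1 -> 0 < Gamma b <= / b.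
Proof.
  intros Hb.
  set (f := fun t => Rpower t (b - 1) * exp (- t)).
  assert (Hc : forall t, 0 < t -> continuous f t)
    by (intros; now apply continuous_Rpower_exp).
  assert (H0 : forall t, 0 < t -> 0 <= f t) by (intros; left; apply Rpower_exp_pos).
  destruct (is_RInt_gen_nonneg f (Rbar_locally p_infty) (fun _ => True) (/ b) 1)
    as [l [Hl1 [Hl2 Hl3]]]; [exact Hc | exact H0 | | lra | exact I | | ].
  { intros c Hc0 _; exists c; intros x Hx; split; [lra | exact I]. }
  { intros a c Hac _.
    (* [t^b e^(-t)] performs the integration by parts for Gamma, and [-(1 + b t) e^(-t)] is the
       primitive of the affine majorant. Thus the derivative of [W] exceeds [f] by the nonnegative
       defect of [Rpower_le_affine]. *)
    set (W := fun t => / b * (Rpower t b * exp (- t) - (1 + b * t) * exp (- t))).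
    assert (HW : is_RInt (fun t => f t + / b * ((1 - b + b * t - Rpower t b) * exp (- t)))
      a c (W c - W a)).
    { change (W c - W a) with (minus (W c) (W a)).
      apply (is_RInt_derive W).
      - intros x Hx; rewrite Rmin_left in Hx by lra; unfold W.
        replace (f x + / b * ((1 - b + b * x - Rpower x b) * exp (- x))) with
          (/ b * ((b * Rpower x (b - 1)) * exp (- x) + Rpower x b * (- exp (- x))
            - (b * exp (- x) + (1 + b * x) * (- exp (- x)))))
          by (unfold f; field; lra).
        assert (D1 := is_derive_Rpower b x ltac:(lra)).
        assert (D2 : is_derive (fun t => exp (- t)) x (- exp (- x)))
          by (auto_derive; [exact I | ring]).
        assert (D3 : is_derive (fun t => 1 + b * t) x b)
          by (auto_derive; [exact I | ring]).
        apply is_derive_scal.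
        apply (is_derive_minus (fun t => Rpower t b * exp (- t))).
        + exact (is_derive_mult _ _ x _ _ D1 D2 Rmult_comm).
        + exact (is_derive_mult _ _ x _ _ D3 D2 Rmult_comm).
      - intros x Hx; rewrite Rmin_left in Hx by lra.
        apply (continuous_plus f); [apply Hc; lra | ].
        apply (continuous_scal_r (/ b)
          (fun t => (1 - b + b * t - Rpower t b) * exp (- t))).
        apply (continuous_mult (fun t => 1 - b + b * t - Rpower t b));
          [ | apply continuous_exp_opp].
        apply (continuous_minus (fun t => 1 - b + b * t));
          [ | apply continuous_Rpower; lra].
        apply (ex_derive_continuous (K := R_AbsRing) (V := R_NormedModule)).
        auto_derive; exact I. }
    apply Rle_trans with (W c - W a).
    - apply (is_RInt_le f _ a c) with (3 := HW); [lra | | ].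
      + apply (RInt_correct (V := R_CompleteNormedModule)), ex_RInt_pos; auto; lra.
      + intros t Ht; assert (H := Rpower_le_affine b t ltac:(lra) ltac:(lra)).
        assert (Hi : 0 < / b) by (apply Rinv_0_lt_compat; lra).
        assert (He := exp_pos (- t)).
        assert (0 <= / b * ((1 - b + b * t - Rpower t b) * exp (- t))); [ | lra].
        apply Rmult_le_pos; [lra | apply Rmult_le_pos; lra].
    - assert (Hi : 0 < / b) by (apply Rinv_0_lt_compat; lra).
      assert (W1 : W c <= 0).
      { unfold W; assert (H := Rpower_le_affine b c ltac:(lra) ltac:(lra)).
        assert (He := exp_pos (- c)).
        assert (0 <= / b * ((1 + b * c - Rpower c b) * exp (- c))); [ | lra].
        apply Rmult_le_pos; [lra | apply Rmult_le_pos; lra]. }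
      assert (W2 : - W a <= / b).
      { unfold W; assert (H1 := exp_pos (- a)).
        assert (H2 := Rpower_exp_pos b a).
        assert (H3 : (1 + b * a) * exp (- a) <= 1).
        { apply Rle_trans with (exp a * exp (- a)).
          - apply Rmult_le_compat_r; [lra | ].
            apply Rle_trans with (1 + a); [nra | apply exp_ineq1_le].
          - rewrite <- exp_plus, Rplus_opp_r, exp_0; lra. }
        apply Rle_trans with (/ b * 1); [ | lra].
        replace (- (/ b * (Rpower a b * exp (- a) - (1 + b * a) * exp (- a)))) with
          (/ b * ((1 + b * a) * exp (- a) - Rpower a b * exp (- a))) by ring.
        apply Rmult_le_compat_l; lra. }
      lra. }
  assert (E : Gamma b = l) by (apply is_RInt_gen_unique; exact Hl1).
  rewrite E; split; [ | exact Hl2].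
  apply Rlt_le_trans with (RInt f 1 2); [ | apply Hl3; [lra | exact I]].
  apply RInt_gt_0; [lra | | ].
  - intros x Hx; apply Rpower_exp_pos.
  - intros x Hx; apply Hc; lra.
Qed.

(** * The function H *)

Lemma exp_nondecreasing x y : x <= y -> exp x <= exp y.
Proof. intros [H | ->]; [left; now apply exp_increasing | apply Rle_refl]. Qed.

Section MinimumOfH.
Context (beta : R) (Hbeta : 0 <= beta < 1).

Let f := fun s => Rpower s (- beta) * exp (- s).

Let Hc : forall t, 0 < t -> continuous f t.
Proof. intros t Ht; now apply continuous_Rpower_exp. Qed.

Let H0 : forall t, 0 < t -> 0 <= f t.
Proof. intros t Ht; left; apply Rpower_exp_pos. Qed.

(** Convergence at [0] comes from [beta < 1]; the lower bound from [s^(-beta) >= eta^(-beta)] for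
    [s <= eta]. *)
Lemma incomplete_gamma_spec eta : 0 < eta ->
  is_RInt_gen f (at_right 0) (at_point eta) (RInt_gen f (at_right 0) (at_point eta)) /\
  Rpower eta (- beta) * (1 - exp (- eta)) <= RInt_gen f (at_right 0) (at_point eta).
Proof.
  intros He.
  destruct (is_RInt_gen_nonneg f (at_point eta) (fun b => b = eta)
    (Rpower eta (1 - beta) / (1 - beta)) eta) as [l [Hl1 [_ Hl3]]];
    [exact Hc | exact H0 | | exact He | reflexivity | | ].
  { intros b _ ->; split; [apply Rle_refl | reflexivity]. }
  { intros a b Hab ->.
    assert (HI := is_RInt_Rpower (1 - beta) a eta ltac:(lra) Hab).
    apply Rle_trans with ((Rpower eta (1 - beta) - Rpower a (1 - beta)) / (1 - beta)).
    - apply (is_RInt_le f _ a eta) with (3 := HI); [lra | | ].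
      + apply (RInt_correct (V := R_CompleteNormedModule)), ex_RInt_pos; auto; lra.
      + intros t Ht; unfold f; replace (1 - beta - 1) with (- beta) by ring.
        assert (H1 := Rpower_pos t (- beta)).
        assert (H2 : exp (- t) <= 1)
          by (rewrite <- exp_0; left; apply exp_increasing; lra).
        nra.
    - assert (H1 := Rpower_pos a (1 - beta)).
      apply Rmult_le_compat_r; [left; apply Rinv_0_lt_compat; lra | lra]. }
  assert (E : RInt_gen f (at_right 0) (at_point eta) = l)
    by (apply is_RInt_gen_unique; exact Hl1).
  rewrite E; split; [exact Hl1 | ].
  apply le_epsilon; intros eps Heps.
  assert (Hp := Rpower_pos eta (- beta)).
  set (a := Rmin eta (eps / Rpower eta (- beta))).
  assert (Ha : 0 < a) by (apply Rmin_pos; [lra | now apply Rdiv_lt_0_compat]).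
  assert (Hae : a <= eta) by apply Rmin_l.
  assert (Hap : Rpower eta (- beta) * a <= eps).
  { apply Rle_trans with (Rpower eta (- beta) * (eps / Rpower eta (- beta))).
    - apply Rmult_le_compat_l; [lra | apply Rmin_r].
    - right; field; lra. }
  assert (HJ : is_RInt (fun s => Rpower eta (- beta) * exp (- s)) a eta
    (Rpower eta (- beta) * (exp (- a) - exp (- eta)))).
  { replace (Rpower eta (- beta) * (exp (- a) - exp (- eta))) with
      (minus (- Rpower eta (- beta) * exp (- eta)) (- Rpower eta (- beta) * exp (- a)))
      by (unfold minus, plus, opp; simpl; ring).
    apply (is_RInt_derive (fun s => - Rpower eta (- beta) * exp (- s))).
    - intros x _; auto_derive; [exact I | ring].
    - intros x _; apply (continuous_scal_r _ (fun s => exp (- s))), continuous_exp_opp. }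
  assert (HJ' : Rpower eta (- beta) * (exp (- a) - exp (- eta)) <= RInt f a eta).
  { apply (is_RInt_le _ f a eta) with (2 := HJ); [lra | | ].
    - apply (RInt_correct (V := R_CompleteNormedModule)), ex_RInt_pos; auto.
    - intros t Ht; apply Rmult_le_compat_r; [left; apply exp_pos | ].
      apply Rpower_decr; lra. }
  assert (Hl := Hl3 a eta ltac:(lra) eq_refl).
  assert (He1 := exp_ineq1_le (- a)).
  assert (H1 : Rpower eta (- beta) * (1 - a - exp (- eta)) <=
    Rpower eta (- beta) * (exp (- a) - exp (- eta)))
    by (apply Rmult_le_compat_l; lra).
  lra.
Qed.

Lemma incomplete_gamma_continuous eta : 0 < eta ->
  continuous (fun e => RInt_gen f (at_right 0) (at_point e)) eta.
Proof.
  intros He.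
  apply (continuous_ext_loc _
    (fun e => RInt_gen f (at_right 0) (at_point eta) + RInt f eta e)).
  - exists (mkposreal eta He); intros y Hy.
    change (Rabs (y - eta) < eta) in Hy; apply Rabs_lt_between in Hy.
    symmetry; apply is_RInt_gen_unique.
    apply (is_RInt_gen_Chasles f eta); [apply incomplete_gamma_spec, He | ].
    apply is_RInt_gen_at_point.
    apply (RInt_correct (V := R_CompleteNormedModule)), ex_RInt_pos; auto; lra.
  - apply (continuous_plus (fun _ => RInt_gen f (at_right 0) (at_point eta)));
      [apply continuous_const | ].
    apply (ex_derive_continuous (K := R_AbsRing) (V := R_NormedModule)).
    exists (f eta); apply (is_derive_RInt f _ eta); [ | now apply Hc].
    exists (mkposreal eta He); intros y Hy.
    change (Rabs (y - eta) < eta) in Hy; apply Rabs_lt_between in Hy.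
    apply (RInt_correct (V := R_CompleteNormedModule)), ex_RInt_pos; auto; lra.
Qed.

Lemma Rpower_ge_self eta : 0 < eta < 1 -> eta <= Rpower eta beta.
Proof.
  intros He; rewrite <- (Rpower_1 eta) at 1 by lra; apply exp_nondecreasing.
  assert (Hl : ln eta < 0) by (rewrite <- ln_1; apply ln_increasing; lra).
  nra.
Qed.

(** The exponent [beta (ln beta - 1)] is at least [-1], by [ln x <= x - 1] at [x = 1 / beta];
    finally [e <= 3]. *)
Lemma M_ge_third : / 3 <= M_ beta.
Proof.
  unfold M_; destruct Req_EM_T as [Hb | Hb]; [lra | ].
  assert (Hb0 : 0 < beta) by lra.
  assert (H1 : ln (/ beta) <= / beta - 1).
  { assert (H := exp_ineq1_le (ln (/ beta))).
    rewrite exp_ln in H by now apply Rinv_0_lt_compat. lra. }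
  rewrite ln_Rinv in H1 by exact Hb0.
  apply (Rmult_le_compat_l beta) in H1; [ | lra].
  replace (beta * (/ beta - 1)) with (1 - beta) in H1 by (field; lra).
  apply Rle_trans with (exp (- (1))).
  - rewrite exp_Ropp; apply Rinv_le_contravar; [apply exp_pos | apply exp_le_3].
  - unfold Rpower; rewrite ln_div, ln_exp by (try apply exp_pos; lra).
    apply exp_nondecreasing; lra.
Qed.

(** The bracket multiplying [M_ beta / eta] is at least [e^(-eta) + (1 - e^(-eta)) = 1], by the
    lower bound on the incomplete Gamma integral. *)
Lemma H_ge eta : 0 < eta < 1 ->
  Rpower eta beta / (1 - eta) + M_ beta / eta <= H_ beta eta.
Proof.
  intros He; unfold H_; apply Rplus_le_compat_l.
  rewrite <- (Rmult_1_r (M_ beta / eta)) at 1.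
  apply Rmult_le_compat_l.
  { apply Rlt_le, Rdiv_lt_0_compat; [assert (H := M_ge_third); lra | lra]. }
  destruct (incomplete_gamma_spec eta (proj1 He)) as [_ H].
  apply (Rmult_le_compat_l (Rpower eta beta)) in H; [ | left; apply Rpower_pos].
  rewrite <- Rmult_assoc, <- Rpower_plus, Rplus_opp_r, Rpower_O in H by lra.
  unfold f in H; lra.
Qed.

Lemma H_lower_bound eta : 0 < eta < 1 -> 36 / 25 <= H_ beta eta.
Proof.
  intros He; eapply Rle_trans; [ | now apply H_ge].
  assert (H1 : eta <= Rpower eta beta).
  { now apply Rpower_ge_self. }
  assert (H2 := M_ge_third).
  apply Rle_trans with (eta / (1 - eta) + / 3 / eta).
  (* Completing the square in the numerator [183 eta^2 - 133 eta + 25] of the difference, which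
     leaves a positive constant. *)
  - replace (eta / (1 - eta) + / 3 / eta) with
      (36 / 25 + (183 * (eta - 133 / 366) ^ 2 + 611 / 732) / (75 * (1 - eta) * eta))
      by (field; lra).
    assert (H3 : 0 < 75 * (1 - eta) * eta) by (apply Rmult_lt_0_compat; lra).
    assert (H4 : 0 <= (183 * (eta - 133 / 366) ^ 2 + 611 / 732) / (75 * (1 - eta) * eta)).
    { apply Rlt_le, Rdiv_lt_0_compat; [ | exact H3].
      assert (H4 := pow2_ge_0 (eta - 133 / 366)); lra. }
    lra.
  - apply Rplus_le_compat; (apply Rmult_le_compat_r;
      [left; apply Rinv_0_lt_compat; lra | assumption]).
Qed.

Lemma H_min_exists : exists K, is_min_01 (H_ beta) K.
Proof.
  assert (HM := M_ge_third).
  set (v := H_ beta (1 / 2)).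
  assert (Hv : 36 / 25 <= v) by (apply H_lower_bound; lra).
  (* Outside [[a, 1 - a]] one of the two terms in [H_ge] blows up: [M_ beta / eta] is at least
     [4 v / 3] for [eta < a], and the other at least [2 v] for [eta > 1 - a]. As [1 / 2] lies
     inside, the minimum over the compact interval is global. *)
  set (a := / 4 / v).
  assert (Ha : 0 < a < 1 / 4).
  { unfold a; split; [apply Rdiv_lt_0_compat; lra | ].
    apply Rmult_lt_reg_r with v; [lra | ].
    replace (/ 4 / v * v) with (/ 4) by (field; lra); lra. }
  assert (Hav : a * v = / 4) by (unfold a; field; lra).
  assert (Hcont : forall c, a <= c <= 1 - a -> continuity_pt (H_ beta) c).
  { intros c Hcc; apply continuity_pt_filterlim.
    change (continuous (H_ beta) c); unfold H_.
    assert (HP : continuous (fun e => Rpower e beta) c) by (apply continuous_Rpower; lra).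
    apply (continuous_plus (fun e => Rpower e beta / (1 - e))).
    - apply (continuous_mult (fun e => Rpower e beta) (fun e => / (1 - e)));
        [exact HP | ].
      apply (ex_derive_continuous (K := R_AbsRing) (V := R_NormedModule)).
      auto_derive; lra.
    - apply (continuous_mult (fun e => M_ beta / e)).
      + apply (ex_derive_continuous (K := R_AbsRing) (V := R_NormedModule)).
        auto_derive; lra.
      + apply (continuous_plus (fun e => exp (- e))); [apply continuous_exp_opp | ].
        apply (continuous_mult (fun e => Rpower e beta)); [exact HP | ].
        apply incomplete_gamma_continuous; lra. }
  destruct (continuity_ab_min (H_ beta) a (1 - a)) as [m [Hm1 Hm2]];
    [lra | exact Hcont | ].
  exists (H_ beta m); split; [exists m; split; [lra | reflexivity] | ].
  intros eta He.
  destruct (Rlt_or_le eta a) as [H1 | H1]; [ | destruct (Rlt_or_le (1 - a) eta) as [H2 | H2]].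
  - apply Rle_trans with v; [apply Hm1; lra | ].
    eapply Rle_trans; [ | apply H_ge, He].
    assert (H3 : 0 < Rpower eta beta / (1 - eta))
      by (apply Rdiv_lt_0_compat; [apply Rpower_pos | lra]).
    assert (H4 : v <= M_ beta / eta).
    { apply Rmult_le_reg_r with eta; [lra | ].
      unfold Rdiv; rewrite Rmult_assoc, Rinv_l by lra; nra. }
    lra.
  - apply Rle_trans with v; [apply Hm1; lra | ].
    eapply Rle_trans; [ | apply H_ge, He].
    assert (H3 : 0 < M_ beta / eta) by (apply Rdiv_lt_0_compat; lra).
    assert (H4 : 1 / 2 <= Rpower eta beta).
    { apply Rle_trans with eta; [lra | now apply Rpower_ge_self]. }
    assert (H5 : v <= Rpower eta beta / (1 - eta)).
    { apply Rmult_le_reg_r with (1 - eta); [lra | ].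
      unfold Rdiv; rewrite Rmult_assoc, Rinv_l by lra; nra. }
    lra.
  - apply Hm1; lra.
Qed.

(** The three terms are at least [1], [M_ beta] and [M_ beta], so the sum is at least [5 / 3]. *)
Lemma explicit_constant_ge :
  36 / 25 <= Rpower 2 (1 - beta) + 2 * M_ beta / exp (1 / 2) + M_ beta / (1 - beta).
Proof.
  assert (HM := M_ge_third).
  assert (H1 : 1 <= Rpower 2 (1 - beta)).
  { rewrite <- (Rpower_O 2) at 1 by lra; apply Rle_Rpower; lra. }
  assert (H2 : exp (1 / 2) <= 2).
  { assert (H := exp_le_3); assert (Hp := exp_pos (1 / 2)).
    replace 1 with (1 / 2 + 1 / 2) in H by field; rewrite exp_plus in H; nra. }
  assert (Hp := exp_pos (1 / 2)).
  assert (H3 : M_ beta <= 2 * M_ beta / exp (1 / 2)).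
  { apply Rmult_le_reg_r with (exp (1 / 2)); [exact Hp | ].
    unfold Rdiv; rewrite Rmult_assoc, Rinv_l by lra; nra. }
  assert (H4 : M_ beta <= M_ beta / (1 - beta)).
  { apply Rmult_le_reg_r with (1 - beta); [lra | ].
    unfold Rdiv; rewrite Rmult_assoc, Rinv_l by lra; nra. }
  lra.
Qed.

End MinimumOfH.

(** * Fractional powers *)

(** This makes the time-discretization error uniform over a period. Each [t] gets a radius good for
    [y] and for [S r (y t)], and compactness makes the radius uniform. The factor [2] leaves room
    for both the distance from the centre and the increment [s]. *)
Lemma orbit_uniform {X : NormedModule R_AbsRing} {S : R -> X -> X}
    (HS : C0_semigroup S) (Hcon : forall t x, 0 <= t -> norm (S t x) <= norm x)
    (y : R -> X) (a b eps : R) :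
  (forall t e, 0 < e -> exists d, 0 < d /\
     forall s, Rabs (s - t) < d -> norm (minus (y s) (y t)) < e) ->
  0 < eps ->
  exists d, 0 < d /\ forall t s r, a <= t <= b -> 0 <= s < d -> 0 <= r < d ->
    norm (y (t + s)) <= norm (S r (y t)) + eps.
Proof.
  intros Hy Heps.
  assert (Hloc : forall t, exists d : posreal,
    (forall s, Rabs (s - t) < 2 * d -> norm (minus (y s) (y t)) < eps / 5) /\
    (forall r, 0 <= r < d -> norm (minus (S r (y t)) (y t)) < eps / 5)).
  { intros t.
    destruct (Hy t (eps / 5)) as [d1 [Hd1 H1]]; [lra | ].
    destruct (C0_cont0 HS (y t) (eps / 5)) as [d2 [Hd2 H2]]; [lra | ].
    assert (Hd : 0 < Rmin (d1 / 2) d2) by (apply Rmin_pos; lra).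
    assert (L1 := Rmin_l (d1 / 2) d2); assert (L2 := Rmin_r (d1 / 2) d2).
    exists (mkposreal _ Hd); simpl; split.
    - intros s Hs; apply H1; lra.
    - intros r Hr; apply H2; lra. }
  set (delta := fun t => proj1_sig (constructive_indefinite_description _ (Hloc t))).
  assert (Hdelta : forall t,
    (forall s, Rabs (s - t) < 2 * delta t -> norm (minus (y s) (y t)) < eps / 5) /\
    (forall r, 0 <= r < delta t -> norm (minus (S r (y t)) (y t)) < eps / 5))
    by (intros t; exact (proj2_sig (constructive_indefinite_description _ (Hloc t)))).
  clearbody delta.
  destruct (compactness_value_1d a b delta) as [d Hd].
  exists d; split; [apply cond_pos | intros x s r Hx Hs Hr].
  apply Rnot_lt_le; intros Hlt; apply (Hd x Hx); intros [t [_ [Hxt Hdt]]].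
  revert Hlt; apply Rle_not_lt.
  destruct (Hdelta t) as [H1 H2].
  apply Rabs_lt_between in Hxt.
  assert (E1 := H1 (x + s) ltac:(apply Rabs_lt_between; lra)).
  assert (E2 := H1 x ltac:(apply Rabs_lt_between; lra)).
  assert (E3 := H2 r ltac:(lra)).
  assert (HSr := C0_linear HS r (proj1 Hr)).
  assert (E4 := Hcon r (minus (y t) (y x)) (proj1 Hr)).
  rewrite (linear_minus _ _ _ HSr), (norm_minus_sym (y t)) in E4.
  assert (T1 := norm_triangle_inv (y (x + s)) (y t)); apply Rabs_le_between in T1.
  assert (T2 := norm_triangle_inv (S r (y t)) (y t)); apply Rabs_le_between in T2.
  assert (T3 := norm_triangle_inv (S r (y t)) (S r (y x))); apply Rabs_le_between in T3.
  lra.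
Qed.

(** Five squarings starting from [exp (1/32) >= 33/32], rounding down in between. *)
Lemma exp_1_ge : 8 / 3 <= exp 1.
Proof.
  assert (Hsq : forall a x, 0 <= a -> a <= exp x -> a ^ 2 <= exp (2 * x)).
  { intros a x Ha Hx; replace (2 * x) with (x + x) by ring; rewrite exp_plus; nra. }
  assert (H0 := exp_ineq1_le (/ 32)).
  assert (H1 := Hsq (33 / 32) (/ 32) ltac:(lra) ltac:(lra)).
  assert (H2 := Hsq (10634 / 10000) (2 * / 32) ltac:(lra) ltac:(lra)).
  assert (H3 := Hsq (11308 / 10000) (2 * (2 * / 32)) ltac:(lra) ltac:(lra)).
  assert (H4 := Hsq (12787 / 10000) (2 * (2 * (2 * / 32))) ltac:(lra) ltac:(lra)).
  assert (H5 := Hsq (1635 / 1000) (2 * (2 * (2 * (2 * / 32)))) ltac:(lra) ltac:(lra)).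
  replace (2 * (2 * (2 * (2 * (2 * / 32))))) with 1 in H5 by field; lra.
Qed.

(** The left side is [(b/2)^(-b) / 2]. The inequality [e x <= e^x] with [8 / 3] in place of [e],
    taken at [x = 3 / (4 b)], gives [-b ln (b/2) <= 3/4], and [exp (3/4) <= 12/5]. *)
Lemma Rpower_constant_le b : 0 < b < 1 -> / b * Rpower (b / 2) (1 - b) <= 6 / 5.
Proof.
  intros Hb.
  assert (Hz : / (b / 2) <= exp (3 / (4 * b))).
  { replace (3 / (4 * b)) with (1 + (3 / (4 * b) - 1)) by ring.
    rewrite exp_plus.
    assert (H1 := exp_1_ge); assert (H2 := exp_ineq1_le (3 / (4 * b) - 1)).
    assert (H3 : 0 < 3 / (4 * b)) by (apply Rdiv_lt_0_compat; lra).
    apply Rle_trans with (8 / 3 * (3 / (4 * b))); [right; field; lra | ].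
    apply Rmult_le_compat; lra. }
  assert (Hln : - ln (b / 2) <= 3 / (4 * b)).
  { rewrite <- ln_Rinv by lra; rewrite <- (ln_exp (3 / (4 * b))).
    apply ln_le; [apply Rinv_0_lt_compat; lra | exact Hz]. }
  apply (Rmult_le_compat_l b) in Hln; [ | lra].
  replace (b * (3 / (4 * b))) with (3 / 4) in Hln by (field; lra).
  unfold Rminus; rewrite Rpower_plus, Rpower_1 by lra.
  replace (/ b * (b / 2 * Rpower (b / 2) (- b))) with (Rpower (b / 2) (- b) / 2)
    by (field; lra).
  assert (He : Rpower (b / 2) (- b) <= exp (3 / 4))
    by (apply exp_nondecreasing; lra).
  assert (He2 : exp (3 / 4) <= 12 / 5).
  { apply Rnot_lt_le; intros Hlt.
    assert (E : exp (3 / 4) * exp (3 / 4) * (exp (3 / 4) * exp (3 / 4)) = exp 1 ^ 3).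
    { simpl; rewrite <- !exp_plus, Rmult_1_r, <- !exp_plus; f_equal; field. }
    assert (H3 := exp_le_3); assert (Hp := exp_pos 1).
    assert (E1 : exp 1 ^ 3 <= 27).
    { replace 27 with (3 ^ 3) by ring; apply pow_incr; lra. }
    assert (E2 : 144 / 25 < exp (3 / 4) * exp (3 / 4)) by nra.
    nra. }
  lra.
Qed.

Lemma semigroup_cases {X : NormedModule R_AbsRing} (A : operator X) :
  generated_by_opp A (semigroup A) \/ forall t x, semigroup A t x = zero.
Proof.
  unfold semigroup; destruct excluded_middle_informative as [H | H].
  - left; exact (proj2_sig (constructive_indefinite_description _ H)).
  - now right.
Qed.

Section FractionalPower.
Context {X : NormedModule R_AbsRing} {ip : X -> X -> R}
  (Hip : is_inner_product ip) {A : operator X}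
  (HS : C0_semigroup (semigroup A))
  (Hcon : forall t x, 0 <= t -> norm (semigroup A t x) <= norm x)
  (Hsym : forall t x y, 0 <= t -> ip (semigroup A t x) y = ip x (semigroup A t y))
  {beta : R} (Hbeta : 0 <= beta < 1).

Lemma pow_graph_minus x1 y1 x2 y2 :
  pow_graph A beta x1 y1 -> pow_graph A beta x2 y2 ->
  pow_graph A beta (minus x1 x2) (minus y1 y2).
Proof.
  intros [[Hb E1] | [Hb H1]] [[Hb' E2] | [Hb' H2]]; try lra.
  - left; split; [exact Hb | now rewrite E1, E2].
  - right; split; [exact Hb | ].
    assert (H := is_RInt_gen_minus _ _ _ _ H1 H2).
    replace (scal (Gamma beta) (minus x1 x2)) with
      (minus (scal (Gamma beta) x1) (scal (Gamma beta) x2)) by (ip_eq Hip; ring).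
    revert H; apply is_RInt_gen_ext.
    apply (Filter_prod _ _ _ (fun a => 0 < a) (fun b => 0 < b)).
    + exists (mkposreal 1 Rlt_0_1); intros t _ Ht; exact Ht.
    + now exists 0.
    + intros a b Ha Hb0 t Ht; simpl in Ht.
      assert (Ht0 : 0 < t) by (eapply Rlt_trans; [ | apply Ht]; now apply Rmin_pos).
      rewrite (linear_minus _ _ _ (C0_linear HS t (Rlt_le _ _ Ht0))).
      ip_eq Hip; ring.
Qed.

(** The discrete form of the bound of [A^beta x] by [(A + 2/T) x], with one constant for all [beta];
    the smoothing [3 * h] on the left comes from the pairing. *)
Lemma pow_graph_estimate T h x y :
  0 < T -> 0 < h -> pow_graph A beta x y ->
  norm (semigroup A (3 * h) y) <= 6 / 5 * Rpower T (1 - beta) *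
    norm (semigroup A h (plus (scal (/ h) (minus x (semigroup A h x))) (scal (2 / T) x))).
Proof.
  intros HT Hh [[Hb ->] | [Hb H]].
  (* For [beta = 0] the pairing is direct: the difference term is nonnegative because the form
     decreases, and [<S(4h) x, x> >= <S(6h) x, x> = |S(3h) x|^2]. This even gives the constant
     [T / 2]. *)
  - rewrite Hb, Rminus_0_r, Rpower_1 by exact HT.
    set (S := semigroup A) in *.
    set (w := S h _).
    assert (E : ip w (S (3 * h) x) = / h * (ip (S (4 * h) x) x - ip (S (5 * h) x) x)
      + 2 / T * ip (S (4 * h) x) x).
    { unfold w; rewrite Hsym, <- (C0_plus HS) by lra.
      replace (h + 3 * h) with (4 * h) by ring.
      ip_expand Hip; rewrite !(ip_sym Hip x), (Hsym h x), <- (C0_plus HS) by lra.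
      replace (h + 4 * h) with (5 * h) by ring.
      rewrite (ip_sym Hip x); reflexivity. }
    assert (H1 := form_decr Hip HS Hcon Hsym x (4 * h) (5 * h) ltac:(lra)).
    assert (H2 := form_decr Hip HS Hcon Hsym x (4 * h) (3 * h + 3 * h) ltac:(lra)).
    rewrite (form_square Hip HS Hsym x (3 * h)) in H2 by lra.
    set (n := norm (S (3 * h) x)) in *.
    assert (H3 := ip_le_norm Hip w (S (3 * h) x)); fold n in H3; rewrite E in H3.
    assert (Hn : 0 <= n) by apply norm_ge_0; assert (Hw := norm_ge_0 w).
    assert (Hih : 0 < / h) by now apply Rinv_0_lt_compat.
    assert (H4 : 0 <= / h * (ip (S (4 * h) x) x - ip (S (5 * h) x) x))
      by (apply Rmult_le_pos; lra).
    assert (H2T : 0 < 2 / T) by (apply Rdiv_lt_0_compat; lra).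
    apply (Rmult_le_compat_l (2 / T)) in H2; [ | lra].
    assert (H5 : 2 / T * n ^ 2 <= norm w * n) by lra.
    apply (Rmult_le_compat_l (T / 2)) in H5; [ | lra].
    replace (T / 2 * (2 / T * n ^ 2)) with (n ^ 2) in H5 by (field; lra).
    apply Rle_trans with (T / 2 * norm w); [ | nra].
    destruct Hn as [Hn | Hn]; [ | rewrite <- Hn; nra].
    apply Rmult_le_reg_r with n; nra.
  - assert (HG := Gamma_pos_le beta ltac:(lra)).
    (* [d = T * (beta / 2)] makes the shift [beta / d] equal to [2 / T]. *)
    assert (HB := pow_graph_bound Hip HS Hcon Hsym beta (Gamma beta) x y h
      (T * (beta / 2)) ltac:(lra) Hh ltac:(nra) ltac:(lra) H).
    replace (beta / (T * (beta / 2))) with (2 / T) in HB by (field; lra).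
    eapply Rle_trans; [exact HB | apply Rmult_le_compat_r; [apply norm_ge_0 | ]].
    rewrite <- Rpower_mult_distr by lra.
    assert (HC := Rpower_constant_le beta ltac:(lra)).
    assert (HP1 := Rpower_pos T (1 - beta)).
    assert (HP2 := Rpower_pos (beta / 2) (1 - beta)).
    apply Rle_trans with (Rpower T (1 - beta) * (/ beta * Rpower (beta / 2) (1 - beta))).
    + replace (Gamma beta * (Rpower T (1 - beta) * Rpower (beta / 2) (1 - beta))) with
        (Rpower T (1 - beta) * (Gamma beta * Rpower (beta / 2) (1 - beta))) by ring.
      apply Rmult_le_compat_l; [lra | apply Rmult_le_compat_r; lra].
    + nra.
Qed.

(** Letting [h] tend to [0] in the estimate with [x = 0]. This makes [pow_graph] single-valued, so
    that the choice in [pow_app] is determined and additive. *)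
Lemma pow_graph_zero_l y : pow_graph A beta zero y -> y = zero.
Proof.
  intros H; apply norm_eq_zero, Rle_antisym; [ | apply norm_ge_0].
  apply le_epsilon; intros eps He.
  destruct (C0_cont0 HS y eps He) as [d [Hd Hc]].
  assert (H1 := pow_graph_estimate 1 (d / 6) zero y Rlt_0_1 ltac:(lra) H).
  assert (H2 := Hc (3 * (d / 6)) ltac:(lra)).
  assert (T1 := norm_triangle_inv (semigroup A (3 * (d / 6)) y) y).
  apply Rabs_le_between in T1.
  assert (HSd := C0_linear HS (d / 6) ltac:(lra)).
  assert (E : norm (semigroup A (d / 6) (plus (scal (/ (d / 6))
      (minus (zero : X) (semigroup A (d / 6) zero))) (scal (2 / 1) (zero : X)))) = 0).
  { transitivity (norm (zero : X)); [apply f_equal | apply norm_zero].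
    rewrite (linear_plus _ HSd), !(linear_scal _ HSd), (linear_minus _ _ _ HSd).
    rewrite !(linear_zero _ HSd); ip_eq Hip; ring. }
  assert (H3 := Rle_trans _ _ _ H1 (Req_le _ _ (f_equal (Rmult _) E))).
  rewrite Rmult_0_r in H3; lra.
Qed.

Lemma pow_graph_zero_r x : pow_graph A beta x zero -> x = zero.
Proof.
  intros [[_ ->] | [Hb H]]; [reflexivity | ].
  assert (HG := Gamma_pos_le beta ltac:(lra)).
  apply norm_eq_zero, Rle_antisym; [ | apply norm_ge_0].
  apply le_epsilon; intros eps He.
  destruct (is_RInt_gen_approx _ _ (Gamma beta * eps) 1 1 H) as [a [b [I [Ha [Hb1 [HI HIn]]]]]];
    [apply Rmult_lt_0_compat; lra | lra | ].
  assert (HI0 : norm I <= (b - a) * 0).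
  { refine (norm_RInt_le_const _ a b I 0 _ _ HI); [lra | intros t Ht].
    rewrite (linear_zero _ (C0_linear HS t ltac:(lra))), norm_scal_abs, norm_zero; lra. }
  rewrite norm_minus_sym in HIn.
  assert (T1 := norm_triangle_inv (scal (Gamma beta) x) I); apply Rabs_le_between in T1.
  rewrite norm_scal_abs, Rabs_pos_eq in T1 by lra.
  rewrite Rmult_0_r in HI0.
  apply Rmult_le_reg_l with (Gamma beta); lra.
Qed.

Lemma pow_app_graph x : pow_dom A beta x -> pow_graph A beta x (pow_app A beta x).
Proof. intros H; unfold pow_app; now apply epsilon_spec. Qed.

Lemma pow_app_unique x y : pow_graph A beta x y -> pow_app A beta x = y.
Proof.
  intros H.
  assert (H1 := pow_graph_minus _ _ _ _ (pow_app_graph x (ex_intro _ y H)) H).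
  assert (E : minus x x = zero) by (ip_eq Hip; ring).
  rewrite E in H1; apply pow_graph_zero_l in H1.
  apply (ip_ext Hip); intros z; apply (f_equal (fun w => ip w z)) in H1.
  rewrite (ip_minus_l Hip), (ip_zero_l Hip) in H1; lra.
Qed.

Lemma pow_app_minus x1 x2 : pow_dom A beta x1 -> pow_dom A beta x2 ->
  pow_app A beta (minus x1 x2) = minus (pow_app A beta x1) (pow_app A beta x2).
Proof.
  intros H1 H2; apply pow_app_unique, pow_graph_minus; now apply pow_app_graph.
Qed.

End FractionalPower.

(** * Periodic solutions *)

Section PeriodicSolution.
Context {X : NormedModule R_AbsRing} {ip : X -> X -> R}
  (Hip : is_inner_product ip) (Hcomplete : seq_complete X) {A : operator X}
  (Hsa : self_adjoint ip A) (Hpos : positive_operator A)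
  (Hgen : generated_by_opp A (semigroup A))
  {beta : R} (Hbeta : 0 <= beta < 1)
  {f : X -> X} {L : R} (HL : 0 < L) (Hf : pow_lipschitz A beta L f)
  {u : R -> X} {T : R} (HT : 0 < T) (Hu : periodic_solution A beta f u T).

Let S := semigroup A.
Let HS : C0_semigroup S := proj1 Hgen.

Let Hcon t x : 0 <= t -> norm (S t x) <= norm x.
Proof. exact (semigroup_contraction Hip Hcomplete Hsa Hpos Hgen t x). Qed.

Let Hsym t x y : 0 <= t -> ip (S t x) y = ip x (S t y).
Proof. exact (semigroup_sym Hip Hcomplete Hsa Hpos Hgen t x y). Qed.

Let Y t := pow_app A beta (u t).

Let Hdom t : pow_dom A beta (u t).
Proof. apply Hu. Qed.

Lemma pow_app_solution_minus s t :
  pow_app A beta (minus (u s) (u t)) = minus (Y s) (Y t).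
Proof. now apply (pow_app_minus Hip HS Hcon Hsym Hbeta). Qed.

Lemma solution_continuous t e : 0 < e -> exists d, 0 < d /\
  forall s, Rabs (s - t) < d -> norm (minus (Y s) (Y t)) < e.
Proof.
  intros He.
  destruct (proj1 (filterlim_locally _ _) (proj2 (proj1 Hu) t) (mkposreal e He))
    as [d Hd].
  exists d; split; [apply cond_pos | intros s Hs].
  assert (H := Hd s Hs).
  change (Rabs (pow_norm A beta (minus (u s) (u t)) - 0) < e) in H.
  unfold pow_norm in H; rewrite pow_app_solution_minus, Rminus_0_r, Rabs_pos_eq in H
    by apply norm_ge_0.
  exact H.
Qed.

(** Subtract the one-step mild formulas at [a] and [a + tau]. The remainder is the integral of
    [S(a + h - s)] applied to a difference of values of [f], bounded by contractivity and the
    Lipschitz condition. *)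
Lemma mild_difference tau a h M :
  0 < h ->
  (forall s, a <= s <= a + h -> norm (minus (Y (s + tau)) (Y s)) <= M) ->
  norm (minus (minus (u (a + h + tau)) (u (a + h)))
    (S h (minus (u (a + tau)) (u a)))) <= h * L * M.
Proof.
  intros Hh HM.
  destruct Hu as [_ [_ Hmild]].
  destruct (Hmild a (a + h)) as [I1 [HI1 E1]]; [lra | ].
  destruct (Hmild (a + tau) (a + h + tau)) as [I2 [HI2 E2]]; [lra | ].
  replace (a + h - a) with h in E1 by ring.
  replace (a + h + tau - (a + tau)) with h in E2 by ring.
  replace (minus (minus (u (a + h + tau)) (u (a + h)))
    (S h (minus (u (a + tau)) (u a)))) with (minus I2 I1).
  2: { rewrite E1, E2, (linear_minus _ _ _ (C0_linear HS h ltac:(lra))).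
       ip_eq Hip; unfold S; ring. }
  assert (HI2' : is_RInt (fun s => S (a + h - s) (f (u (s + tau)))) a (a + h) I2).
  { assert (H : is_RInt (fun s => S (a + h + tau - s) (f (u s)))
      (1 * a + tau) (1 * (a + h) + tau) I2).
    { replace (1 * a + tau) with (a + tau) by ring.
      replace (1 * (a + h) + tau) with (a + h + tau) by ring; exact HI2. }
    apply is_RInt_comp_lin in H; revert H; apply is_RInt_ext; intros s _.
    replace (1 * s + tau) with (s + tau) by ring.
    replace (a + h + tau - (s + tau)) with (a + h - s) by ring.
    exact (scal_one _). }
  assert (HD := is_RInt_minus _ _ _ _ _ _ HI2' HI1).
  replace (h * L * M) with ((a + h - a) * (L * M)) by ring.
  refine (norm_RInt_le_const _ a (a + h) _ (L * M) _ _ HD); [lra | intros s Hs].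
  fold S; assert (HSs := C0_linear HS (a + h - s) ltac:(lra)).
  rewrite <- (linear_minus _ _ _ HSs).
  eapply Rle_trans; [apply Hcon; lra | ].
  eapply Rle_trans; [now apply Hf | ].
  apply Rmult_le_compat_l; [lra | ].
  unfold pow_norm; rewrite pow_app_solution_minus; now apply HM.
Qed.

(** The time step is [tau / n], so [n] steps make the shift and [N = m * n] steps the period. This
    exact divisibility makes the sampled differences periodic with zero sum. *)
Lemma shift_invariant (m : nat) t :
  L * Rpower T (1 - beta) * (36 / 25) < 1 -> (0 < m)%nat ->
  u (t + T / INR m) = u t.
Proof.
  intros Hlow Hm.
  assert (HmR : 0 < INR m) by now apply lt_0_INR.
  set (tau := T / INR m).
  set (V := fun a => (minus (u (a + tau)) (u a) : X)).
  set (Z := fun a => (minus (Y (a + tau)) (Y a) : X)).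
  assert (HZ : forall a e, 0 < e -> exists d, 0 < d /\
    forall s, Rabs (s - a) < d -> norm (minus (Z s) (Z a)) < e).
  { intros a e He.
    destruct (solution_continuous (a + tau) (e / 2)) as [d1 [Hd1 H1]]; [lra | ].
    destruct (solution_continuous a (e / 2)) as [d2 [Hd2 H2]]; [lra | ].
    exists (Rmin d1 d2); split; [now apply Rmin_pos | intros s Hs].
    assert (M1 := Rmin_l d1 d2); assert (M2 := Rmin_r d1 d2).
    assert (G1 := H1 (s + tau)); assert (G2 := H2 s ltac:(lra)).
    replace (s + tau - (a + tau)) with (s - a) in G1 by ring.
    assert (G1' := G1 ltac:(lra)).
    replace (minus (Z s) (Z a)) with
      (minus (minus (Y (s + tau)) (Y (a + tau))) (minus (Y s) (Y a)))
      by (unfold Z; ip_eq Hip; ring).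
    unfold minus at 1; eapply Rle_lt_trans; [apply norm_triangle | ].
    rewrite norm_opp; lra. }
  assert (HVZ : forall a, pow_graph A beta (V a) (Z a)).
  { intros a; apply (pow_graph_minus Hip HS); apply pow_app_graph, Hdom. }
  assert (Hsmall : forall eps, 0 < eps -> norm (V t) <= (8 * (L * T) + 1) * eps).
  { intros eps Heps.
    destruct (orbit_uniform HS Hcon Z t (t + T) eps HZ Heps) as [d1 [Hd1 Huni]].
    destruct (C0_cont0 HS (V t) eps Heps) as [d2 [Hd2 Hc0]].
    (* [h < d1 / 3] makes [3 * h] admissible as the smoothing time in [Huni], and [h < d2] allows
       [S h] to be removed from [V t] at the end. *)
    destruct (archimed_cor1 (Rmin (d1 / 3) d2 / tau)) as [n [Hn1 Hn2]].
    { apply Rdiv_lt_0_compat; [apply Rmin_pos; lra | ].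
      now apply Rdiv_lt_0_compat. }
    assert (HnR : 0 < INR n) by now apply lt_0_INR.
    assert (Htau : 0 < tau) by now apply Rdiv_lt_0_compat.
    set (h := tau / INR n).
    assert (Hh : 0 < h) by now apply Rdiv_lt_0_compat.
    assert (Hhd : h < Rmin (d1 / 3) d2).
    { unfold h, Rdiv at 1; apply (Rmult_lt_compat_l tau) in Hn1; [ | exact Htau].
      replace (tau * (Rmin (d1 / 3) d2 / tau)) with (Rmin (d1 / 3) d2) in Hn1
        by (field; lra).
      exact Hn1. }
    assert (M1 := Rmin_l (d1 / 3) d2); assert (M2 := Rmin_r (d1 / 3) d2).
    set (N := (m * n)%nat).
    assert (HN : (0 < N)%nat) by (unfold N; lia).
    assert (HNR : 0 < INR N) by now apply lt_0_INR.
    assert (HNh : INR N * h = T).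
    { unfold N, h, tau; rewrite mult_INR; field; lra. }
    assert (Hnh : INR n * h = tau) by (unfold h; field; lra).
    set (v := fun j => V (t + INR j * h)).
    assert (HSh := C0_linear HS h (Rlt_le _ _ Hh)).
    assert (Hsh : forall x y, ip (S h x) y = ip x (S h y)) by (intros; apply Hsym; lra).
    assert (Hposh : forall x, norm (S h x) ^ 2 <= ip x (S h x)).
    { intros x; rewrite (ip_sym Hip), <- (form_square Hip HS Hsym) by lra.
      apply (form_decr Hip HS Hcon Hsym); lra. }
    assert (Hper : forall j, u (t + INR (j + N) * h) = u (t + INR j * h)).
    { intros j; rewrite plus_INR, Rmult_plus_distr_r, HNh, <- Rplus_assoc.
      apply Hu. }
    assert (HVu : forall j, v j = minus (u (t + INR (j + n) * h)) (u (t + INR j * h))).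
    { intros j; unfold v, V; rewrite plus_INR, Rmult_plus_distr_r, Hnh, Rplus_assoc.
      reflexivity. }
    assert (Hvper : forall j, v (j + N)%nat = v j).
    { intros j; rewrite !HVu, Hper.
      replace (j + N + n)%nat with (j + n + N)%nat by lia; now rewrite Hper. }
    assert (Hmean : forall z, psum (fun j => ip (v j) z) N = 0).
    { intros z.
      rewrite (psum_ext _ (fun j => ip (u (t + INR (j + n) * h)) z
        + (-1) * ip (u (t + INR j * h)) z))
        by (intros j; rewrite HVu, (ip_minus_l Hip); ring).
      rewrite psum_plus, psum_scal.
      rewrite (psum_shift (fun j => ip (u (t + INR j * h)) z))
        by (intros j; now rewrite Hper).
      ring. }
    assert (Hrange : forall j, (j < N)%nat -> t <= t + INR j * h <= t + T).
    { intros j Hj; assert (H1 := pos_INR j).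
      assert (H2 : INR j <= INR N) by (apply le_INR; lia).
      rewrite <- HNh; split; nra. }
    (* [25 / 27] equals [4/3 * (6/5)^2 * (25/36)^2]. With this [q] the numerical prefactor in the
       conclusion is [63 <= 8^2], the origin of the [8] in [Hsmall]. *)
    assert (Hrig := discrete_rigidity Hip HSh Hsh Hposh HN Hvper Hmean
      (fun j => norm (S (3 * h) (Z (t + INR j * h)))) h L
      (6 / 5 * Rpower T (1 - beta)) (25 / 27) eps Hh (Rlt_le _ _ HL)
      (Rlt_le _ _ Heps) ltac:(lra)).
    assert (HTb := Rpower_pos T (1 - beta)).
    assert (Hfin := Hrig
      ltac:(replace (4 / 3 * (6 / 5 * Rpower T (1 - beta) * L) ^ 2) with
        (25 / 27 * (L * Rpower T (1 - beta) * (36 / 25)) ^ 2) by field;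
        assert (0 <= L * Rpower T (1 - beta) * (36 / 25)) by nra; nra)).
    clear Hrig.
    assert (Hfin' : norm (S h (v O)) ^ 2 <= (8 * (L * T) * eps) ^ 2).
    { eapply Rle_trans; [apply Hfin | rewrite HNh; nra].
      - intros j Hj; split; [apply norm_ge_0 | ].
        eapply Rle_trans;
          [apply (pow_graph_estimate Hip HS Hcon Hsym Hbeta T h (v j)); auto; apply HVZ | ].
        fold S.
        set (nv := norm (S h (plus (minus (v j) (S h (v j))) (scal (2 / INR N) (v j))))).
        replace (6 / 5 * Rpower T (1 - beta) / h * nv) with
          (6 / 5 * Rpower T (1 - beta) * (/ h * nv)) by (field; lra).
        right; apply f_equal; unfold nv.
        rewrite <- (Rabs_pos_eq (/ h)) by (left; now apply Rinv_0_lt_compat).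
        rewrite <- norm_scal_abs, <- (linear_scal _ HSh).
        apply f_equal, f_equal; rewrite <- HNh; ip_eq Hip.
        rewrite Rabs_pos_eq by (left; now apply Rinv_0_lt_compat).
        fold S; field; lra.
      - intros j Hj.
        assert (Hj1 := Hrange j Hj).
        unfold v at 1, V; rewrite S_INR.
        replace (t + (INR j + 1) * h) with (t + INR j * h + h) by ring.
        apply mild_difference; [exact Hh | intros s Hs].
        replace s with (t + INR j * h + (s - (t + INR j * h))) by ring.
        apply Huni; lra. }
    assert (Hv0 : v O = V t) by (unfold v; simpl; now rewrite Rmult_0_l, Rplus_0_r).
    rewrite Hv0 in Hfin'.
    assert (Hb : norm (S h (V t)) <= 8 * (L * T) * eps).
    { apply Rsqr_incr_0; [unfold Rsqr; lra | apply norm_ge_0 | ].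
      assert (0 < L * T) by nra; nra. }
    assert (Hc1 := Hc0 h ltac:(lra)).
    assert (T1 := norm_triangle_inv (S h (V t)) (V t)); apply Rabs_le_between in T1.
    lra. }
  assert (H0 : norm (V t) = 0).
  { apply Rle_antisym; [ | apply norm_ge_0].
    assert (HLT : 0 < 8 * (L * T) + 1) by nra.
    apply le_epsilon; intros eps He.
    eapply Rle_trans; [apply (Hsmall (eps / (8 * (L * T) + 1))) | ].
    - now apply Rdiv_lt_0_compat.
    - right; field; lra. }
  apply norm_eq_zero in H0.
  apply (ip_ext Hip); intros z; apply (f_equal (fun w => ip w z)) in H0.
  unfold V in H0; rewrite (ip_minus_l Hip), (ip_zero_l Hip) in H0; lra.
Qed.

(** [u] has the arbitrarily small periods [T / m], and continuity of [A^beta u] then gives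
    [A^beta (u t - u s) = 0]; injectivity of [A^beta] concludes. *)
Lemma solution_constant :
  L * Rpower T (1 - beta) * (36 / 25) < 1 -> forall s t, u s = u t.
Proof.
  intros Hlow.
  assert (Hmult : forall m t k, (0 < m)%nat -> u (t + INR k * (T / INR m)) = u t).
  { intros m t k Hm; induction k as [ | k IH].
    - simpl; now rewrite Rmult_0_l, Rplus_0_r.
    - rewrite S_INR, Rmult_plus_distr_r, Rmult_1_l, <- Rplus_assoc.
      now rewrite shift_invariant. }
  assert (Hle : forall s t, t <= s -> u t = u s).
  { intros s t Hst.
    assert (Hd : pow_dom A beta (minus (u t) (u s))).
    { eexists; apply (pow_graph_minus Hip HS); apply pow_app_graph, Hdom. }
    assert (H0 : pow_app A beta (minus (u t) (u s)) = zero).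
    { apply norm_eq_zero, Rle_antisym; [ | apply norm_ge_0].
      apply le_epsilon; intros eps He.
      destruct (solution_continuous s eps He) as [d [Hd0 Hc]].
      destruct (archimed_cor1 (d / T)) as [m [Hm1 Hm2]];
        [now apply Rdiv_lt_0_compat | ].
      assert (HmR : 0 < INR m) by now apply lt_0_INR.
      assert (Hp : 0 < T / INR m) by now apply Rdiv_lt_0_compat.
      destruct (nfloor_ex ((s - t) / (T / INR m))) as [k Hk].
      { apply Rmult_le_pos; [lra | left; now apply Rinv_0_lt_compat]. }
      assert (Hsmall : T / INR m < d).
      { apply (Rmult_lt_compat_l T) in Hm1; [ | exact HT].
        replace (T * (d / T)) with d in Hm1 by (field; lra); exact Hm1. }
      assert (Hk1 : INR k * (T / INR m) <= s - t).
      { apply Rle_trans with ((s - t) / (T / INR m) * (T / INR m)).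
        - apply Rmult_le_compat_r; lra.
        - right; field; lra. }
      assert (Hk2 : s - t < (INR k + 1) * (T / INR m)).
      { apply Rle_lt_trans with ((s - t) / (T / INR m) * (T / INR m)).
        - right; field; lra.
        - apply Rmult_lt_compat_r; lra. }
      assert (H1 := Hc (t + INR k * (T / INR m)) ltac:(apply Rabs_lt_between; lra)).
      rewrite <- pow_app_solution_minus, (Hmult m t k Hm2) in H1; lra. }
    assert (Hg := pow_app_graph _ Hd); rewrite H0 in Hg.
    apply (pow_graph_zero_r HS Hbeta) in Hg.
    apply (ip_ext Hip); intros z; apply (f_equal (fun w => ip w z)) in Hg.
    rewrite (ip_minus_l Hip), (ip_zero_l Hip) in Hg; lra. }
  intros s t; destruct (Rle_or_lt t s); [symmetry | ]; apply Hle; lra.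
Qed.

End PeriodicSolution.

(** * The junk semigroup and the numerical bounds *)

Lemma zero_semigroup_constant {X : NormedModule R_AbsRing} (A : operator X)
    (f : X -> X) (u : R -> X) :
  (forall t x, semigroup A t x = zero) -> mild_solution A f u -> forall s t, u s = u t.
Proof.
  intros Hz Hm.
  assert (H : forall t, u t = zero).
  { intros t; destruct (Hm (t - 1) t) as [I [HI E]]; [lra | ].
    assert (HI0 : norm I <= (t - (t - 1)) * 0).
    { refine (norm_RInt_le_const _ _ _ I 0 _ _ HI); [lra | intros s _].
      rewrite Hz, norm_zero; lra. }
    rewrite E, Hz, plus_zero_l; apply norm_eq_zero.
    assert (H := norm_ge_0 I); lra. }
  intros s t; now rewrite !H.
Qed.

(** The bound weakens as [K] grows, so any [K] above [36 / 25] is allowed: the minimum of [H_], the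
    explicit constant, or [4]. *)
Lemma period_bound (beta L K T : R) :
  beta < 1 -> 0 < L -> 0 < T -> 36 / 25 <= K ->
  1 <= L * Rpower T (1 - beta) * (36 / 25) ->
  T >= 1 / (Rpower L (1 / (1 - beta)) * Rpower K (1 / (1 - beta))).
Proof.
  intros Hb HL HT HK H.
  assert (Hp := Rpower_pos T (1 - beta)).
  assert (H1 : 1 <= L * K * Rpower T (1 - beta)).
  { eapply Rle_trans; [exact H | ].
    replace (L * K * Rpower T (1 - beta)) with (L * Rpower T (1 - beta) * K) by ring.
    apply Rmult_le_compat_l; [apply Rmult_le_pos; lra | exact HK]. }
  rewrite Rpower_mult_distr by lra.
  assert (Hi : 0 < 1 / (1 - beta)) by (apply Rdiv_lt_0_compat; lra).
  assert (HLK : 0 < L * K) by (apply Rmult_lt_0_compat; lra).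
  assert (H2 : Rpower 1 (1 / (1 - beta)) <=
    Rpower (L * K * Rpower T (1 - beta)) (1 / (1 - beta)))
    by (apply Rle_Rpower_l; lra).
  rewrite <- Rpower_mult_distr, Rpower_mult in H2 by (try apply Rpower_pos; lra).
  replace ((1 - beta) * (1 / (1 - beta))) with 1 in H2 by (field; lra).
  rewrite Rpower_1 in H2 by exact HT.
  replace (Rpower 1 (1 / (1 - beta))) with 1 in H2
    by (unfold Rpower; now rewrite ln_1, Rmult_0_r, exp_0).
  assert (Hq := Rpower_pos (L * K) (1 / (1 - beta))).
  apply Rle_ge, Rmult_le_reg_l with (Rpower (L * K) (1 / (1 - beta))); [exact Hq | ].
  unfold Rdiv at 2; rewrite Rmult_1_l, Rinv_r; lra.
Qed.

Theorem theorem3 (X : CompleteNormedModule R_AbsRing) (ip : X -> X -> R)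
    (Hip : is_inner_product ip) (Hsep : separable X)
    (A : operator X) (Hsa : self_adjoint ip A) (Hpos : positive_operator A)
    (beta : R) (Hbeta : 0 <= beta < 1)
    (f : X -> X) (L : R) (HL : 0 < L) (Hf : pow_lipschitz A beta L f)
    (u : R -> X) (T : R) (HT : 0 < T) (Hu : periodic_solution A beta f u T)
    (Hnc : ~ (forall s t, u s = u t)) :
  (exists K : R, is_min_01 (H_ beta) K /\
     T >= 1 / Rpower (L * K) (1 / (1 - beta))) /\
  (0 < beta ->
     T >= 1 / (Rpower L (1 / (1 - beta)) *
               Rpower (Rpower 2 (1 - beta) + 2 * M_ beta / exp (1 / 2)
                       + M_ beta / (1 - beta)) (1 / (1 - beta)))) /\
  (beta = 0 -> T >= 1 / (4 * L)).
Proof.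
  assert (Hmain : 1 <= L * Rpower T (1 - beta) * (36 / 25)).
  { apply Rnot_lt_le; intros Hlow; apply Hnc.
    destruct (semigroup_cases A) as [Hgen | Hz].
    - exact (solution_constant Hip (CompleteNormedModule_seq_complete X)
        Hsa Hpos Hgen Hbeta HL Hf HT Hu Hlow).
    - exact (zero_semigroup_constant A f u Hz (proj2 (proj2 Hu))). }
  split; [ | split].
  - destruct (H_min_exists beta Hbeta) as [K HK].
    assert (HK1 : 36 / 25 <= K).
    { destruct HK as [[eta [Heta <-]] _]; now apply H_lower_bound. }
    exists K; split; [exact HK | ].
    rewrite <- Rpower_mult_distr by lra; apply period_bound; auto; lra.
  - intros _; apply period_bound; auto; [lra | now apply explicit_constant_ge].
  - intros ->; assert (H := period_bound 0 L 4 T ltac:(lra) HL HT ltac:(lra) Hmain).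
    replace (1 / (1 - 0)) with 1 in H by field.
    rewrite !Rpower_1, (Rmult_comm L 4) in H by lra; exact H.
Qed.
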